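(* Let $\Gamma=(K,A,S,q,g)$ be a blind MDP, let $p_1\in\Delta(K)$ be an initial belief and let $\varepsilon>0$. Then there exists a strategy that is $\varepsilon$-optimal in $\Gamma(p_1)$ and eventually periodic (and thus has finite recall).
   Context: For a finite set $C$, $\Delta(C)$ denotes the set of probability distributions on $C$. A POMDP $\Gamma=(K,A,S,q,g)$ consists of a finite state space $K$, a finite action set $A$, a finite signal set $S$, a transition function $q:K\times A\to\Delta(K\times S)$ and a reward function $g:K\times A\to[0,1]$. Given an initial belief $p_1\in\Delta(K)$, the process $\Gamma(p_1)$ runs as follows: an initial state $k_1$ is drawn from $p_1$ (the decision-maker knows $p_1$ but not $k_1$); at each stage $m\ge1$ the decision-maker chooses an action $a_m\in A$, receives (without observing it) the stage reward $g_m:=g(k_m,a_m)$, then a pair $(k_{m+1},s_m)$ is drawn from $q(k_m,a_m)$; the decision-maker observes only the signal $s_m$. Let $H_m:=(A\times S)^{m-1}$ be the set of histories before stage $m$. A strategy is a map $\sigma:\bigcup_{m\ge1}H_m\to A$; $\Sigma$ is the set of strategies. $\mathbb{P}^{p_1}_\sigma$ denotes the law on plays induced by $p_1$ and $\sigma$, $\mathbb{E}^{p_1}_\sigma$ its expectation. The long-run payoff is $\gamma^{p_1}_\infty(\sigma):=\mathbb{E}^{p_1}_\sigma\left(\liminf_{n\to\infty}\frac1n\sum_{m=1}^n g_m\right)$, and the value is $v_\infty(p_1):=\sup_{\sigma\in\Sigma}\gamma^{p_1}_\infty(\sigma)$. A strategy is $\varepsilon$-optimal in $\Gamma(p_1)$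 if $\gamma^{p_1}_\infty(\sigma)\ge v_\infty(p_1)-\varepsilon$. A blind MDP is a POMDP whose signal set $S$ is a singleton; then a strategy is just an infinite sequence of actions $(a_1,a_2,\dots)\in A^{\mathbb{N}}$. Such a strategy is eventually periodic if there exist integers $T\ge1$ and $N\ge1$ with $a_{m+T}=a_m$ for all $m\ge N$. A strategy has finite recall if there exists $M>0$ such that for all $m>M$ and $h_M\in H_M$, the value $\sigma(h_{m-M},h_M)$ does not depend on $h_{m-M}\in H_{m-M}$. *)

(* Defs.v *)
From HB Require Import structures.
From mathcomp Require Import all_boot all_order all_algebra.
From mathcomp Require Import all_classical all_reals all_analysis.
Set Implicit Arguments. Unset Strict Implicit. Unset Printing Implicit Defensive.
Import Order.TTheory GRing.Theory Num.Theory.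
Local Open Scope ring_scope.
Local Open Scope classical_set_scope.

Definition is_distr (R : realType) (C : finType) (p : {ffun C -> R}) : Prop :=
  (forall c, 0 <= p c) /\ \sum_(c : C) p c = 1.

Definition is_POMDP (R : realType) (K A S : finType)
  (q : K -> A -> {ffun (K * S) -> R}) (g : K -> A -> R) : Prop :=
  (forall k a, is_distr (q k a)) /\ (forall k a, 0 <= g k a <= 1).

Definition is_blind_MDP (R : realType) (K A S : finType)
  (q : K -> A -> {ffun (K * S) -> R}) (g : K -> A -> R) : Prop :=
  is_POMDP q g /\ #|S| = 1%N.

(* In a blind MDP a strategy is a sequence of actions; stages indexed from 0. *)
Definition strategy (A : finType) := nat -> A.

Definition trans (R : realType) (K A S : finType)
  (q : K -> A -> {ffun (K * S) -> R}) (k : K) (a : A) (k' : K) : R :=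
  \sum_(s : S) q k a (k', s).

(* A family of state processes X sigma m (state at stage m, 0-based) on a
   common probability space, one for each strategy sigma, each having the
   law of the play induced by p1 and sigma. *)
Definition realizes (R : realType) (K A S : finType) (d : measure_display)
  (Omega : measurableType d) (P : probability Omega R)
  (p1 : {ffun K -> R}) (q : K -> A -> {ffun (K * S) -> R})
  (X : strategy A -> nat -> Omega -> K) : Prop :=
  (forall sigma m k, measurable (X sigma m @^-1` [set k])) /\
  (forall sigma (n : nat) (x : nat -> K),
     P [set w | forall m, (m <= n)%N -> X sigma m w = x m] =
     (p1 (x 0%N) * \prod_(m < n) trans q (x m) (sigma m) (x m.+1))%:E).

Definition avg_reward (R : realType) (K A : finType) (Omega : Type)
  (g : K -> A -> R) (X : strategy A -> nat -> Omega -> K)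
  (sigma : strategy A) (w : Omega) (n : nat) : R :=
  (n.+1%:R)^-1 * \sum_(m < n.+1) g (X sigma m w) (sigma m).

Definition gamma_inf (R : realType) (K A : finType) (d : measure_display)
  (Omega : measurableType d) (P : probability Omega R)
  (g : K -> A -> R) (X : strategy A -> nat -> Omega -> K)
  (sigma : strategy A) : \bar R :=
  (\int[P]_w limn_einf (fun n => (avg_reward g X sigma w n)%:E))%E.

Definition v_inf (R : realType) (K A : finType) (d : measure_display)
  (Omega : measurableType d) (P : probability Omega R)
  (g : K -> A -> R) (X : strategy A -> nat -> Omega -> K) : \bar R :=
  ereal_sup [set gamma_inf P g X sigma | sigma in [set: strategy A]].

Definition eps_optimal (R : realType) (K A : finType) (d : measure_display)
  (Omega : measurableType d) (P : probability Omega R)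
  (g : K -> A -> R) (X : strategy A -> nat -> Omega -> K)
  (eps : R) (sigma : strategy A) : Prop :=
  (gamma_inf P g X sigma >= v_inf P g X - eps%:E)%E.

Definition eventually_periodic (A : Type) (sigma : nat -> A) : Prop :=
  exists T N : nat, (1 <= T)%N /\ forall m, (N <= m)%N -> sigma (m + T)%N = sigma m.

(* Main.v *)
Require Import Defs.
From HB Require Import structures.
From mathcomp Require Import all_boot all_order all_algebra.
From mathcomp Require Import all_classical all_reals all_analysis.
From mathcomp Require Import measurable_realfun ring lra zify.
Set Implicit Arguments. Unset Strict Implicit. Unset Printing Implicit Defensive.
Import Order.TTheory GRing.Theory Num.Theory.
Import numFieldNormedType.Exports.
Local Open Scope ring_scope.
Local Open Scope classical_set_scope.

(** By Fatou's lemma the payoff of a sequence of actions is at most the lower limit of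
    its expected average rewards, so it suffices to approximate the latter by an
    eventually periodic sequence. Follow the law of the state along a sequence of
    actions, and label the states of its support so that labels never change along a
    play. Among all such labelled trajectories that start from limits of reachable
    beliefs and keep the average reward, take one with the maximal number of labels.
    If a bounded harmonic function were not constant on a label class, a limit of time
    shifts of the trajectory would carry a finer labelling; hence harmonic functions
    are constant on classes, and the chain forgets its position inside its class. A
    long block of actions between two times with equal supports and labels can then be
    repeated forever: no mass leaks between classes, and from the second block on the
    expected reward of a block depends on the class only. A bounded potential turns
    this into an almost sure lower bound for the averages, by an exponential moment
    estimate and the Borel-Cantelli lemma. All limits are taken along one free
    ultrafilter on nat. *)

(** * Limits along a free ultrafilter on the integers *)

Section UltraLimits.
Variable R : realType.

Lemma free_ultrafilter : exists U : set_system nat, UltraFilter U /\ \oo `<=` U.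
Proof. exact: (@ultraFilterLemma nat \oo _). Qed.

Variable U : set_system nat.
Context {UU : UltraFilter U}.

Lemma ultra_fin (F : finType) (f : nat -> F) : exists c, U [set i | f i = c].
Proof.
apply: contrapT => /forallNP noc.
have UC c : U [set i | f i <> c].
  by have [/noc|//] := in_ultra_setVsetC [set i | f i = c] UU.
have /filter_ex[i /(_ (f i))] : \forall i \near U, forall c, f i <> c.
  exact: filter_forall.
exact.
Qed.

(** Compactness gives a cluster point, and an ultrafilter converges to each of its cluster
    points. *)
Lemma ultra_cvg (x : nat -> R) (M : R) :
  (forall i, `|x i| <= M) -> exists l : R, x @ U --> l.
Proof.
move=> xM.
have FA : (x @ U) `[- M, M].
  by rewrite /= /fmap /=; apply: filterE => i /=; rewrite in_itv /= -ler_norml.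
have [l [_ cl]] := @segment_compact R (- M) M (x @ U) _ FA.
exists l => V lV.
have [//|nV] := in_ultra_setVsetC (x @^-1` V) UU.
by have [y []] := cl (~` V) V nV lV.
Qed.

Definition ulim (x : nat -> R) : R := lim (x @ U).

Lemma ulimP (x : nat -> R) (M : R) :
  (forall i, `|x i| <= M) -> x @ U --> ulim x.
Proof. by move=> /ultra_cvg[l xl]; apply/cvg_ex; exists l. Qed.

Hypothesis ooU : \oo `<=` U.

Lemma cvg_ultra (x : nat -> R) (l : R) : x @ \oo --> l -> x @ U --> l.
Proof. by move=> xl V /xl; exact: ooU. Qed.

Lemma ultra_ge (n : nat) : U [set i | (n <= i)%N].
Proof. by apply: ooU; exact: nbhs_infty_ge. Qed.

End UltraLimits.

(* An occurrence of low averages from every late position would chain up into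
   arbitrarily long low averages from m0. *)
Lemma good_position (R : realType) (x : nat -> R) (v : R) (m0 : nat) (e : R) :
  (forall m, 0 <= x m) -> 0 < e ->
  (forall d, 0 < d -> exists n0, forall n, (n0 <= n)%N ->
     n%:R * (v - d) <= \sum_(m < n) x m) ->
  exists m, (m0 <= m)%N /\
    forall n, n%:R * (v - e) <= \sum_(s < n) x (m + s)%N.
Proof.
move=> x0 e0 H; apply: contrapT => /forallNP no.
have {}no m : (m0 <= m)%N -> exists n, \sum_(s < n) x (m + s)%N < n%:R * (v - e).
  move=> m0m; apply: contrapT => /forallNP h; apply: (no m); split => // n.
  by rewrite leNgt; apply/negP; exact: h.
have chain j : exists n, (j <= n)%N /\
    \sum_(s < n) x (m0 + s)%N <= n%:R * (v - e).
  elim: j => [|j [n [jn Hn]]].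
    by exists 0%N; rewrite big_ord0 mul0r.
  have [[|l] Hl] := no (m0 + n)%N (leq_addr _ _).
    by move: Hl; rewrite big_ord0 mul0r ltxx.
  exists (n + l.+1)%N; split; first by rewrite addnS ltnS (leq_trans jn) ?leq_addr.
  rewrite big_split_ord /= natrD mulrDl lerD //.
  by apply: le_trans (ltW Hl); apply: ler_sum => i _; rewrite addnA.
have e20 : 0 < e / 2 by lra.
have [n0 Hn0] := H _ e20.
(* With tolerance [e / 2] in [H], a chain of length [n] falls short by [n * e / 2], while the first
   [m0] terms compensate at most [C]; [B] makes the chain long enough for a contradiction. *)
pose C := \sum_(m < m0) x m + m0%:R * `|v| + m0%:R * e.
have C0 : 0 <= C by rewrite !addr_ge0 ?sumr_ge0 // mulr_ge0 // ltW.
pose B := (Num.truncn (2 * C / e)).+1.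
have [n [jn Hn]] := chain (n0 + B)%N.
have := Hn0 (m0 + n)%N; rewrite (leq_trans (leq_trans (leq_addr B n0) jn)) ?leq_addl //.
move=> /(_ erefl); apply/negP; rewrite -ltNge.
rewrite big_split_ord /=.
have nB : 2 * C / e < n%:R.
  apply: lt_le_trans (_ : B%:R <= _); last by rewrite ler_nat (leq_trans _ jn) ?leq_addl.
  by apply: truncnS_gt.
have {}nB : 2 * C < n%:R * e by rewrite -ltr_pdivrMr.
have nv : - v <= `|v| by rewrite -normrN ler_norm.
have : m0%:R * - v <= m0%:R * `|v| by rewrite ler_wpM2l.
have m00 : 0 <= m0%:R :> R by [].
have n00 : 0 <= n%:R :> R by [].
rewrite natrD; move: Hn nB; rewrite /C.
set S1 := \sum_(i < m0) _; set S2 := \sum_(i < n) _ => Hn nB mv.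
have : 0 <= m0%:R * e by rewrite mulr_ge0 // ltW.
move: Hn nB mv; rewrite !mulrDr !mulrN !mulrDl => Hn nB mv me.
lra.
Qed.

(** * Convergence of finite sums and comparison of limits *)

Lemma cvgr_sum (R : realType) (T : Type) (F : set_system T) (FF : Filter F)
    (I : finType) (f : I -> T -> R) (l : I -> R) :
  (forall i, f i @ F --> l i) ->
  (fun t => \sum_i f i t) @ F --> \sum_i l i.
Proof.
move=> fl; apply: (@cvg_big R I +%R 0 xpredT _ T F (index_enum I) f l FF).
  exact: add_continuous.
by move=> i _; exact: fl.
Qed.

Lemma cvgr_le (R : realType) (U : set_system nat) (PU : ProperFilter U)
    (x y : nat -> R) (a b : R) :
  x @ U --> a -> y @ U --> b -> U [set i | x i <= y i] -> a <= b.
Proof. by move=> xa yb; exact: ler_cvg_to xa yb. Qed.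

Lemma cvgr_eq (R : realType) (U : set_system nat) (PU : ProperFilter U)
    (x y : nat -> R) (a b : R) :
  x @ U --> a -> y @ U --> b -> U [set i | x i = y i] -> a = b.
Proof.
move=> xa yb xy; apply/eqP; rewrite eq_le; apply/andP; split.
- by apply: cvgr_le xa yb _; apply: filterS xy => i /= ->.
- by apply: cvgr_le yb xa _; apply: filterS xy => i /= ->.
Qed.

Lemma sumr_eq0_pos (R : realType) (I : finType) (f : I -> R) :
  (forall i, 0 <= f i) -> \sum_i f i = 0 -> forall i, f i = 0.
Proof.
move=> f0 /eqP; rewrite psumr_eq0 // => /allP h i.
by apply/eqP/h; rewrite mem_index_enum.
Qed.

(** * Laws of the state driven by actions *)

Section Trajectories.
Variables (R : realType) (K A : finType).
Variables (tr : K -> A -> K -> R) (g : K -> A -> R).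
Hypothesis tr0 : forall k a k', 0 <= tr k a k'.
Hypothesis tr1 : forall k a, \sum_k' tr k a k' = 1.
Hypothesis g01 : forall k a, 0 <= g k a <= 1.

Definition push (p : K -> R) (a : A) : K -> R := fun k' => \sum_k p k * tr k a k'.

Definition pull (a : A) (f : K -> R) : K -> R := fun k => \sum_k' tr k a k' * f k'.

Lemma push_pull p a f :
  \sum_k' push p a k' * f k' = \sum_k p k * pull a f k.
Proof.
rewrite /push /pull; under eq_bigr do rewrite mulr_suml.
rewrite exchange_big /=; apply: eq_bigr => k _.
by rewrite mulr_sumr; apply: eq_bigr => k' _; rewrite mulrA.
Qed.

Lemma pull_cst a c k : pull a (fun=> c) k = c.
Proof. by rewrite /pull -mulr_suml tr1 mul1r. Qed.

Lemma le_pull a f1 f2 k :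
  (forall k', 0 < tr k a k' -> f1 k' <= f2 k') -> pull a f1 k <= pull a f2 k.
Proof.
move=> h; apply: ler_sum => k' _.
have := tr0 k a k'; rewrite le_eqVlt => /predU1P[<-|t0]; first by rewrite !mul0r.
by rewrite ler_pM2l // h.
Qed.

Lemma eq_pull a f1 f2 k :
  (forall k', 0 < tr k a k' -> f1 k' = f2 k') -> pull a f1 k = pull a f2 k.
Proof.
by move=> h; apply/eqP; rewrite eq_le !le_pull // => k' /h ->.
Qed.

Lemma push_ge0 p a : (forall k, 0 <= p k) -> forall k, 0 <= push p a k.
Proof. by move=> p0 k; apply: sumr_ge0 => k' _; rewrite mulr_ge0. Qed.

Lemma push_sum p a : \sum_k push p a k = \sum_k p k.
Proof.
have := push_pull p a (fun=> 1).
under eq_bigr do rewrite mulr1.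
by move=> ->; apply: eq_bigr => k _; rewrite pull_cst mulr1.
Qed.

Fixpoint belief (p : K -> R) (tau : nat -> A) (n : nat) : K -> R :=
  if n is n'.+1 then push (belief p tau n') (tau n') else p.

Lemma eq_belief p tau tau' n :
  (forall i, (i < n)%N -> tau i = tau' i) -> belief p tau n = belief p tau' n.
Proof.
elim: n => [//|n IH] h /=.
by rewrite IH => [|i /ltnW]; [rewrite h | exact: h].
Qed.

Lemma belief_ge0 p tau n k : (forall k, 0 <= p k) -> 0 <= belief p tau n k.
Proof. by move=> p0; elim: n k => [//|n IH] k /=; exact: push_ge0. Qed.

Lemma belief_sum p tau n : \sum_k belief p tau n k = \sum_k p k.
Proof. by elim: n => [//|n IH] /=; rewrite push_sum. Qed.

(** Closeness in l1 norm rather than equality, so that the property passes to limits of time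
    shifts. *)
Definition approachable (p1 p : K -> R) : Prop :=
  forall d, 0 < d -> exists tau n, \sum_k `|belief p1 tau n k - p k| <= d.

Definition reward (pp : nat -> K -> R) (sg : nat -> A) (m : nat) : R :=
  \sum_k pp m k * g k (sg m).

Record trajectory (pp : nat -> K -> R) (sg : nat -> A) : Prop := Trajectory {
  traj_ge0 : forall s k, 0 <= pp s k;
  traj_sum : forall s, \sum_k pp s k = 1;
  traj_rec : forall s k, pp s.+1 k = push (pp s) (sg s) k }.

Lemma belief_trajectory p sg :
  (forall k, 0 <= p k) -> \sum_k p k = 1 -> trajectory (belief p sg) sg.
Proof. by split=> // [s k|s]; [exact: belief_ge0 | rewrite belief_sum]. Qed.

Lemma traj_le1 pp sg : trajectory pp sg -> forall s k, pp s k <= 1.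
Proof.
move=> T s k; rewrite -(traj_sum T s) (bigD1 k) //= lerDl sumr_ge0 // => *.
exact: traj_ge0 T _ _.
Qed.

Lemma reward_ge0 pp sg m : trajectory pp sg -> 0 <= reward pp sg m.
Proof.
move=> T; apply: sumr_ge0 => k _; rewrite mulr_ge0 //; first exact: traj_ge0 T _ _.
by have /andP[] := g01 k (sg m).
Qed.

Lemma reward_le1 pp sg m : trajectory pp sg -> reward pp sg m <= 1.
Proof.
move=> T; rewrite -(traj_sum T m); apply: ler_sum => k _.
rewrite ler_piMr //; first exact: traj_ge0 T _ _.
by have /andP[] := g01 k (sg m).
Qed.

Lemma traj_succ pp sg s k k' : trajectory pp sg ->
  0 < pp s k -> 0 < tr k (sg s) k' -> 0 < pp s.+1 k'.
Proof.
move=> T pk tk; rewrite (traj_rec T) /push (bigD1 k) //=.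
rewrite ltr_wpDr ?mulr_gt0 // sumr_ge0 // => i _.
by rewrite mulr_ge0 // (traj_ge0 T).
Qed.

(** * Functions harmonic along a trajectory, that is, martingales of the play *)

Definition supp_harmonic (pp : nat -> K -> R) (sg : nat -> A) (u : nat -> K -> R) :=
  forall s k, 0 < pp s k -> u s k = pull (sg s) (u s.+1) k.

Section SuppHarmonic.
Variables (pp : nat -> K -> R) (sg : nat -> A).
Hypothesis T : trajectory pp sg.

Lemma traj_pair s f : \sum_k pp s.+1 k * f k = \sum_k pp s k * pull (sg s) f k.
Proof.
by rewrite -push_pull; apply: eq_bigr => k _; rewrite (traj_rec T).
Qed.

Lemma eq_on_supp s f f' : (forall k, 0 < pp s k -> f k = f' k) ->
  \sum_k pp s k * f k = \sum_k pp s k * f' k.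
Proof.
move=> h; apply: eq_bigr => k _.
have := traj_ge0 T s k; rewrite le_eqVlt => /predU1P[<-|/h ->//].
by rewrite !mul0r.
Qed.

Variable u : nat -> K -> R.
Hypothesis hu : supp_harmonic pp sg u.

Lemma supp_harmonic_mean s t : \sum_k pp s k * u s k = \sum_k pp t k * u t k.
Proof.
suff h n : \sum_k pp n k * u n k = \sum_k pp 0 k * u 0%N k by rewrite !h.
elim: n => [//|n <-]; rewrite traj_pair; apply: eq_on_supp => k.
by move=> /hu ->.
Qed.

(** Orthogonality of martingale increments: in the expanded square, harmonicity evaluates the cross
    term. *)
Lemma supp_harmonic_square s :
  \sum_k pp s.+1 k * u s.+1 k ^+ 2 - \sum_k pp s k * u s k ^+ 2 =
  \sum_k pp s k * pull (sg s) (fun k' => (u s.+1 k' - u s k) ^+ 2) k.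
Proof.
rewrite traj_pair -sumrB.
under eq_bigr do rewrite -mulrBr.
apply: eq_on_supp => k pk.
have -> : pull (sg s) (fun k' => (u s.+1 k' - u s k) ^+ 2) k =
    pull (sg s) (fun k' => u s.+1 k' ^+ 2) k
      - 2 * u s k * pull (sg s) (u s.+1) k + u s k ^+ 2 * pull (sg s) (fun=> 1) k.
  rewrite /pull !mulr_sumr -sumrB -big_split /=; apply: eq_bigr => k' _.
  by ring.
by rewrite pull_cst -hu //; ring.
Qed.

Lemma supp_harmonic_square_nd :
  {homo (fun s => \sum_k pp s k * u s k ^+ 2) : n m / (n <= m)%N >-> n <= m}.
Proof.
apply/nondecreasing_seqP => s; rewrite -subr_ge0 supp_harmonic_square.
apply: sumr_ge0 => k _; rewrite mulr_ge0 ?(traj_ge0 T) //.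
by apply: sumr_ge0 => k' _; rewrite mulr_ge0 // sqr_ge0.
Qed.

End SuppHarmonic.

(* lab marks sets of states between which the play cannot move; the number of
   labels in use is bounded by #|K|, hence can be maximised. *)
Record config (v : R) (p1 : K -> R) (L : finType) (pp : nat -> K -> R)
    (sg : nat -> A) (lab : nat -> K -> L) : Prop := Config {
  cf_traj : trajectory pp sg;
  cf_appr : forall m, approachable p1 (pp m);
  cf_lab : forall s k k', 0 < pp s k -> 0 < tr k (sg s) k' ->
    lab s.+1 k' = lab s k;
  cf_rew : forall d, 0 < d -> exists n0, forall n, (n0 <= n)%N ->
    n%:R * (v - d) <= \sum_(m < n) reward pp sg m }.

(** Time 0 is enough: transitions preserve labels and every state has a successor, so a
    configuration uses the same labels at all times. *)
Definition classes (L : finType) (pp : nat -> K -> R) (lab : nat -> K -> L) :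
  {set L} := (lab 0%N @: [pred k | 0 < pp 0%N k])%SET.

Lemma classes_card (L : finType) pp (lab : nat -> K -> L) :
  (#|classes pp lab| <= #|K|)%N.
Proof. exact: leq_trans (leq_imset_card _ _) (max_card _). Qed.

(** Labels are preserved by transitions from the support, so the indicator factors out of [pull];
    off the support this can fail, hence harmonicity is asked on the support only. *)
Lemma config_indicator v p1 (L : finType) pp sg (lab : nat -> K -> L) u c b :
  config v p1 pp sg lab -> supp_harmonic pp sg u ->
  supp_harmonic pp sg (fun s k => (lab s k == c)%:R * (u s k - b)).
Proof.
move=> C hu s k pk /=.
rewrite (@eq_pull _ _ (fun k' => (lab s k == c)%:R * (u s.+1 k' - b))); last first.
  by move=> k' tk; rewrite (cf_lab C pk tk).
rewrite /pull; under eq_bigr do rewrite mulrCA mulrBr.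
rewrite -mulr_sumr sumrB -mulr_suml tr1 mul1r; congr (_ * (_ - _)).
exact: hu.
Qed.


(** * Limits of time shifts of a labelled trajectory *)

Section ShiftLimit.
Variables (U : set_system nat) (UU : UltraFilter U) (ooU : \oo `<=` U).
Variables (v : R) (p1 : K -> R) (L : finType) (pp : nat -> K -> R).
Variables (sg : nat -> A) (lab : nat -> K -> L).
Hypothesis C : config v p1 pp sg lab.
Variable mi : nat -> nat.
Hypothesis mi_ge : forall i, (i <= mi i)%N.
Hypothesis mi_good : forall i n, n%:R * (v - i.+1%:R^-1) <=
  \sum_(s < n) reward pp sg (mi i + s)%N.
Variables (sg' : nat -> A) (lab' : nat -> K -> L).
Hypothesis sg_lim : forall s, U [set i | sg (mi i + s)%N = sg' s].
Hypothesis lab_lim : forall s, U [set i | forall k, lab (mi i + s)%N k = lab' s k].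

Let T := cf_traj C.

Definition shift_lim (u : nat -> K -> R) : nat -> K -> R :=
  fun s k => ulim U (fun i => u (mi i + s)%N k).

Lemma shift_limP u M s k : (forall s k, `|u s k| <= M) ->
  (fun i => u (mi i + s)%N k) @ U --> shift_lim u s k.
Proof. by move=> uM; apply: ulimP => i; exact: uM. Qed.

Notation pp' := (shift_lim pp).

Lemma pp_limP s k : (fun i => pp (mi i + s)%N k) @ U --> pp' s k.
Proof.
apply: (@shift_limP pp 1) => s' k'.
by rewrite ger0_norm ?(traj_ge0 T) ?(traj_le1 T).
Qed.

Lemma lim_pos s k : 0 < pp' s k -> U [set i | 0 < pp (mi i + s)%N k].
Proof. by move=> p0; apply: (cvgr_gt _ (@pp_limP s k)). Qed.

Lemma traj_lim : trajectory pp' sg'.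
Proof.
split.
- move=> s k; apply: (cvgr_le _ (cvg_cst 0) (@pp_limP s k)).
  by apply: filterE => i /=; exact: traj_ge0 T _ _.
- move=> s.
  have h : (fun i => \sum_k pp (mi i + s)%N k) @ U --> \sum_k pp' s k.
    by apply: cvgr_sum => k; exact: pp_limP.
  have h1 : (fun _ : nat => 1 : R) @ U --> (1 : R) by exact: cvg_cst.
  refine (cvgr_eq _ h h1 _).
  by apply: filterE => i /=; exact: traj_sum T _.
- move=> s k; rewrite /push.
  have h : (fun i => \sum_k' pp (mi i + s)%N k' * tr k' (sg' s) k) @ U -->
      \sum_k' pp' s k' * tr k' (sg' s) k.
    by apply: cvgr_sum => k'; apply: cvgM; [exact: pp_limP | exact: cvg_cst].
  apply: (cvgr_eq _ (@pp_limP s.+1 k) h).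
  apply: filterS (sg_lim s) => i /= <-.
  by rewrite addnS (traj_rec T).
Qed.

Lemma appr_lim m : approachable p1 (pp' m).
Proof.
move=> d d0.
have d20 : 0 < d / 2 by lra.
have h : (fun i => \sum_k `|pp (mi i + m)%N k - pp' m k|) @ U --> \sum_(k : K) (0 : R).
  apply: cvgr_sum => k.
  have -> : (0 : R) = `|pp' m k - pp' m k| by rewrite subrr normr0.
  by apply: cvg_norm; apply: cvgB; [exact: pp_limP | exact: cvg_cst].
rewrite big1 // in h.
have [i /= hi] := filter_ex (cvgr_lt _ h _ d20).
have [tau [n hn]] := cf_appr C (mi i + m)%N d20.
exists tau, n.
have -> : d = d / 2 + d / 2 by lra.
apply: le_trans (lerD hn (ltW hi)); rewrite -big_split /=.
apply: ler_sum => k _; exact: ler_distD.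
Qed.

(** For [U]-almost all shifts, actions and labels have their limit values and [k] is in the support;
    one such shift transfers the claim. *)
Lemma lab_lim_const s k k' : 0 < pp' s k -> 0 < tr k (sg' s) k' ->
  lab' s.+1 k' = lab' s k.
Proof.
move=> /lim_pos pk tk.
have [i /= [] []] := filter_ex (filterI (filterI pk (sg_lim s))
  (filterI (lab_lim s) (lab_lim s.+1))).
move=> /= pi si [li li1]; rewrite -li -li1 addnS (cf_lab C pi) //.
by rewrite si.
Qed.

Lemma reward_lim n : n%:R * v <= \sum_(m < n) reward pp' sg' m.
Proof.
have h m : (fun i => reward pp sg (mi i + m)%N) @ U --> reward pp' sg' m.
  have h0 : (fun i => \sum_k pp (mi i + m)%N k * g k (sg' m)) @ U -->
      reward pp' sg' m.
    by apply: cvgr_sum => k; apply: cvgM; [exact: pp_limP | exact: cvg_cst].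
  apply: cvg_trans h0; apply: near_eq_cvg.
  by apply: filterS (sg_lim m) => i /= e; rewrite /reward e.
have h1 : (fun i => n%:R * (v - i.+1%:R^-1)) @ U --> n%:R * (v - 0).
  apply: cvgM; first exact: cvg_cst.
  apply: cvgB; first exact: cvg_cst.
  by apply: cvg_ultra => //; exact: cvg_harmonic.
rewrite subr0 in h1.
have h2 : (fun i => \sum_(m < n) reward pp sg (mi i + m)%N) @ U -->
    \sum_(m < n) reward pp' sg' m by apply: cvgr_sum => m; exact: h.
apply: (cvgr_le _ h1 h2).
by apply: filterE => i; exact: mi_good.
Qed.

Lemma lim_config : config v p1 pp' sg' lab'.
Proof.
split; [exact: traj_lim | exact: appr_lim | exact: lab_lim_const |].
move=> d d0; exists 0%N => n _; apply: le_trans (reward_lim n).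
by rewrite ler_wpM2l // lerBlDr lerDl ltW.
Qed.

Variables (h : nat -> K -> R) (M : R).
Hypothesis hM : forall s k, `|h s k| <= M.
Hypothesis hh : supp_harmonic pp sg h.

Notation h' := (shift_lim h).

(** The second moment of [h] is nondecreasing and bounded, hence convergent, so its increments at
    the times [mi i] vanish in the limit. These increments are expected squared steps of [h], so
    [h'] takes no step. *)
Lemma harmonic_lim_const s k k' : 0 < pp' s k -> 0 < tr k (sg' s) k' ->
  h' s.+1 k' = h' s k.
Proof.
pose Phi s := \sum_k pp s k * h s k ^+ 2.
have M0 (k0 : K) : 0 <= M by exact: le_trans (normr_ge0 _) (hM 0%N k0).
have ub : has_ubound (range Phi).
  exists (M ^+ 2) => _ [t _ <-]; rewrite /Phi -[leRHS]mul1r -(traj_sum T t) mulr_suml.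
  apply: ler_sum => k0 _; rewrite ler_wpM2l ?(traj_ge0 T) //.
  by rewrite -(ger0_norm (sqr_ge0 (h t k0))) normrX lerXn2r ?nnegrE ?(M0 k0).
have Phil := nondecreasing_cvgn (supp_harmonic_square_nd T hh) ub.
have lim0 : (fun i => Phi (mi i + s).+1 - Phi (mi i + s)%N) @ U --> (0 : R).
  rewrite -(subrr (sup (range Phi))).
  have mi_oo t : (fun i => Phi (mi i + t)%N) @ U --> sup (range Phi).
    apply: cvg_ultra => //.
    apply: (@cvg_comp _ _ _ (fun i => mi i + t)%N Phi \oo \oo) => //.
    move=> V [N _ NV]; exists N => // i /= Ni; apply: NV => /=.
    by rewrite (leq_trans Ni) // (leq_trans (mi_ge i)) ?leq_addr.
  apply: cvgB; last exact: mi_oo.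
  by have := mi_oo s.+1; under eq_fun do rewrite addnS.
have lim1 : (fun i => Phi (mi i + s).+1 - Phi (mi i + s)%N) @ U -->
    \sum_k pp' s k * pull (sg' s) (fun k' => (h' s.+1 k' - h' s k) ^+ 2) k.
  have l0 : (fun i => \sum_k pp (mi i + s)%N k * pull (sg' s)
      (fun k' => (h (mi i + s.+1)%N k' - h (mi i + s)%N k) ^+ 2) k) @ U -->
    \sum_k pp' s k * pull (sg' s) (fun k' => (h' s.+1 k' - h' s k) ^+ 2) k.
    apply: cvgr_sum => k0; apply: cvgM; first exact: pp_limP.
    apply: cvgr_sum => k1; apply: cvgM; first exact: cvg_cst.
    by rewrite expr2; apply: cvgM; apply: cvgB; exact: shift_limP hM.
  apply: cvg_trans l0; apply: near_eq_cvg.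
  apply: filterS (sg_lim s) => i /= e.
  by rewrite /Phi (supp_harmonic_square T hh) e addnS.
have T' := traj_lim.
have : \sum_k pp' s k * pull (sg' s) (fun k' => (h' s.+1 k' - h' s k) ^+ 2) k = 0.
  by apply: (cvgr_eq _ lim1 lim0); exact: filterE.
move=> E pk tk.
have pull0 k0 : 0 <= pull (sg' s) (fun k' => (h' s.+1 k' - h' s k0) ^+ 2) k0.
  by apply: sumr_ge0 => k1 _; rewrite mulr_ge0 // sqr_ge0.
have /eqP : pp' s k * pull (sg' s) (fun k' => (h' s.+1 k' - h' s k) ^+ 2) k = 0.
  by apply: (sumr_eq0_pos _ E) => k0; rewrite mulr_ge0 // (traj_ge0 T').
rewrite mulf_eq0 gt_eqF //= => /eqP E2.
have /eqP : tr k (sg' s) k' * (h' s.+1 k' - h' s k) ^+ 2 = 0.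
  by apply: (sumr_eq0_pos _ E2) => k0; rewrite mulr_ge0 // sqr_ge0.
by rewrite mulf_eq0 gt_eqF //= sqrf_eq0 subr_eq0 => /eqP.
Qed.

(** Used with exponents 1 and 2, for the mean and the second moment of [h - b] over a class. The
    label is [U]-almost always equal to its limit, which fixes the indicator. *)
Lemma indicator_limP c b e :
  (fun i => \sum_k pp (mi i + 0)%N k *
     ((lab (mi i + 0)%N k == c)%:R * (h (mi i + 0)%N k - b)) ^+ e) @ U -->
  \sum_k pp' 0%N k * ((lab' 0%N k == c)%:R * (h' 0%N k - b)) ^+ e.
Proof.
apply: (@cvg_trans _ ((fun i => \sum_k pp (mi i + 0)%N k *
     ((lab' 0%N k == c)%:R * (h (mi i + 0)%N k - b)) ^+ e) @ U)).
  apply: near_eq_cvg; apply: filterS (lab_lim 0%N) => i /= hl.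
  by apply: eq_bigr => k _; rewrite hl.
apply: cvgr_sum => k; apply: cvgM; first exact: pp_limP.
have := @exprn_continuous R e ((lab' 0%N k == c)%:R * (h' 0%N k - b)).
apply: cvg_trans; apply: (@cvg_comp _ _ _ _ (fun x : R => x ^+ e)); last exact: cvg_id.
apply: cvgM; first exact: cvg_cst.
by apply: cvgB; [exact: shift_limP hM | exact: cvg_cst].
Qed.

(** On the class, [h - b] is centred at time [s0]. Its mean is preserved and its second moment does
    not decrease, so the limit is centred with positive second moment and takes both signs. *)
Lemma split_class c b s0 k1 : (forall i, (s0 <= mi i)%N) ->
  \sum_k pp s0 k * ((lab s0 k == c)%:R * (h s0 k - b)) = 0 ->
  0 < pp s0 k1 -> lab s0 k1 = c -> h s0 k1 != b ->
  (exists k, [/\ 0 < pp' 0%N k, lab' 0%N k = c & b < h' 0%N k]) /\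
  (exists k, [/\ 0 < pp' 0%N k, lab' 0%N k = c & h' 0%N k < b]).
Proof.
move=> s0mi mean0 pk1 lk1 hk1.
have T' := traj_lim.
pose u s k := (lab s k == c)%:R * (h s k - b).
have hu : supp_harmonic pp sg u by exact: config_indicator C hh.
pose u' k := (lab' 0%N k == c)%:R * (h' 0%N k - b).
have m0 : \sum_k pp' 0%N k * u' k = 0.
  have h0 : (fun _ : nat => 0 : R) @ U --> (0 : R) by exact: cvg_cst.
  have := @indicator_limP c b 1; under eq_fun do under eq_bigr do rewrite expr1.
  under [X in _ --> X]eq_bigr do rewrite expr1.
  move=> h1; apply: (cvgr_eq _ h1 h0); apply: filterE => i /=.
  exact: etrans (supp_harmonic_mean T hu (mi i + 0)%N s0) mean0.
pose V := \sum_k pp s0 k * u s0 k ^+ 2.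
have V0 : 0 < V.
  rewrite /V (bigD1 k1) //= ltr_wpDr //.
    by apply: sumr_ge0 => k _; rewrite mulr_ge0 ?sqr_ge0 // (traj_ge0 T).
  by rewrite mulr_gt0 // exprn_even_gt0 //= /u lk1 eqxx mul1r subr_eq0.
have VV : V <= \sum_k pp' 0%N k * u' k ^+ 2.
  have h0 : (fun _ : nat => V : R) @ U --> V by exact: cvg_cst.
  apply: (cvgr_le _ h0 (@indicator_limP c b 2)); apply: filterE => i /=.
  by apply: (supp_harmonic_square_nd T hu); rewrite addn0.
have key (w : K -> R) : (forall k, 0 < pp' 0%N k -> w k <= 0) ->
    \sum_k pp' 0%N k * w k = 0 -> \sum_k pp' 0%N k * w k ^+ 2 = 0.
  move=> w0 sw.
  have z k : - (pp' 0%N k * w k) = 0.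
    apply: (@sumr_eq0_pos _ _ (fun k => - (pp' 0%N k * w k))); last first.
      by rewrite sumrN sw oppr0.
    move=> k0; have := traj_ge0 T' 0%N k0; rewrite le_eqVlt => /predU1P[<-|pk].
      by rewrite mul0r oppr0.
    by rewrite -mulrN mulr_ge0 ?oppr_ge0 ?w0 // ltW.
  apply: big1 => k _; rewrite expr2 mulrA.
  by have /eqP := z k; rewrite oppr_eq0 => /eqP ->; rewrite mul0r.
split; apply: contrapT => /forallNP no.
- move: (lt_le_trans V0 VV); rewrite key ?ltxx // => k pk.
  rewrite /u'; case: eqP => [lk|]; last by rewrite mul0r.
  rewrite mul1r subr_le0 leNgt; apply/negP => hk.
  by apply: (no k).
- have := key (fun k => - u' k).
  under eq_bigr do rewrite mulrN; rewrite sumrN m0 oppr0.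
  under eq_bigr do rewrite sqrrN.
  move=> E; move: (lt_le_trans V0 VV); rewrite E ?ltxx // => k pk.
  rewrite /u'; case: eqP => [lk|]; last by rewrite mul0r oppr0.
  rewrite mul1r oppr_le0 subr_ge0 leNgt; apply/negP => hk.
  by apply: (no k).
Qed.

Lemma refine_config b :
  config v p1 pp' sg' (fun s k => (lab' s k, b < h' s k)).
Proof.
have [T' a' l' r'] := lim_config; split => // s k k' pk tk.
by rewrite (l' _ _ _ pk tk) (harmonic_lim_const pk tk).
Qed.

End ShiftLimit.

(** The mass of a label is the mean of a harmonic indicator, hence constant in time; the limit keeps
    this positive mass, so no label is lost. *)
Lemma classes_lim (U : set_system nat) (UU : UltraFilter U)
    v p1 (L : finType) pp sg (lab : nat -> K -> L) (mi : nat -> nat) sg' lab' :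
  config v p1 pp sg lab ->
  (forall s, U [set i | sg (mi i + s)%N = sg' s]) ->
  (forall s, U [set i | forall k, lab (mi i + s)%N k = lab' s k]) ->
  (classes pp lab \subset classes (shift_lim U mi pp) lab')%SET.
Proof.
move=> C sgl labl; apply/fintype.subsetP => c /imsetP[k0 /= pk0 ->].
have T := cf_traj C.
have h1 : supp_harmonic pp sg (fun _ _ => 1) by move=> s k _; rewrite pull_cst.
have hu := config_indicator (lab 0%N k0) 0 C h1.
have T' := traj_lim UU C sgl.
have n1 (s : nat) (k : K) : `|1 : R| <= 1 by rewrite normr1.
have lims := @indicator_limP U UU v p1 L pp sg lab C mi lab' labl (fun _ _ => 1) 1 n1
  (lab 0%N k0) 0 1.
set S := (X in _ --> X) in lims.
pose m0 := \sum_k pp 0%N k * ((lab 0%N k == lab 0%N k0)%:R * (1 - 0)).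
have m00 : 0 < m0.
  rewrite /m0 (bigD1 k0) //= eqxx subr0 !mulr1 ltr_wpDr // sumr_ge0 // => k _.
  by rewrite mulr1 mulr_ge0 // (traj_ge0 T).
have SE : S = m0.
  have h0 : (fun _ : nat => m0) @ U --> m0 by exact: cvg_cst.
  apply: (cvgr_eq _ lims h0); apply: filterE => i /=.
  under eq_bigr do rewrite expr1.
  exact (supp_harmonic_mean T hu (mi i + 0)%N 0%N).
have [k /= Hk] : exists k, shift_lim U mi pp 0 k * ((lab' 0%N k == lab 0%N k0)%:R) != 0.
  apply: contrapT => /forallNP no; move: m00; rewrite -SE /S big1 ?ltxx // => k _.
  have /negP := no k; rewrite negbK mulf_eq0 => /orP[]/eqP ->; first by rewrite mul0r.
  by rewrite mul0r expr1 mulr0.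
apply/imsetP; exists k.
  rewrite inE lt_def (traj_ge0 T') andbT.
  by apply: contraNneq Hk => ->; rewrite mul0r.
by apply/esym/eqP; apply: contraNT Hk => /negbTE ->; rewrite mulr0.
Qed.

(** * Trajectories with the maximal number of labels *)

Definition config_rank v p1 (n : nat) : Prop :=
  exists (L : finType) pp sg (lab : nat -> K -> L),
    config v p1 pp sg lab /\ #|classes pp lab| = n.

(* The variance of h over one class is nondecreasing in time, while its increments
   tend to 0: in a limit of time shifts h is constant along plays but still not
   constant on the class, so it splits the class. *)
Lemma rank_increase v p1 (L : finType) pp sg (lab : nat -> K -> L) h (M : R) s0 k1 k2 :
  config v p1 pp sg lab -> (forall s k, `|h s k| <= M) -> supp_harmonic pp sg h ->
  0 < pp s0 k1 -> 0 < pp s0 k2 -> lab s0 k1 = lab s0 k2 -> h s0 k1 != h s0 k2 ->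
  exists n, (#|classes pp lab| < n)%N /\ config_rank v p1 n.
Proof.
move=> C hM hh pk1 pk2 lk12 hk12.
have T := cf_traj C.
have [U [UU ooU]] := free_ultrafilter.
(* Times beyond [s0] are needed because the second moment over the class is bounded below by its
   value at [s0]. *)
have /choice[mi mi_good] : forall i, exists m, (maxn i s0 <= m)%N /\
    forall n, n%:R * (v - i.+1%:R^-1) <= \sum_(s < n) reward pp sg (m + s)%N.
  move=> i; apply: good_position; last exact: cf_rew C.
  - by move=> m; exact: reward_ge0 T.
  - by rewrite invr_gt0.
have mi_i i : (i <= mi i)%N.
  by have [+ _] := mi_good i; apply: leq_trans; exact: leq_maxl.
have mi_s0 i : (s0 <= mi i)%N.
  by have [+ _] := mi_good i; apply: leq_trans; exact: leq_maxr.
have {}mi_good i n := (mi_good i).2 n.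
have /choice[sg' sgl] : forall s, exists a, U [set i | sg (mi i + s)%N = a].
  by move=> s; exact: ultra_fin.
have /choice[lab' labl] : forall s, exists f : K -> L,
    U [set i | forall k, lab (mi i + s)%N k = f k].
  move=> s; have [f hf] := ultra_fin (fun i => [ffun k => lab (mi i + s)%N k]).
  by exists f; apply: filterS hf => i /= <- k; rewrite ffunE.
pose c := lab s0 k1.
pose al := \sum_k pp s0 k * (lab s0 k == c)%:R.
have al0 : 0 < al.
  rewrite /al (bigD1 k1) //= eqxx mulr1 ltr_wpDr // sumr_ge0 // => k _.
  by rewrite mulr_ge0 // (traj_ge0 T).
(* Conditional mean of [h] on the class at time [s0]; as [h] differs at [k1] and [k2], one of the
   two values is not [b]. *)
pose b := (\sum_k pp s0 k * (lab s0 k == c)%:R * h s0 k) / al.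
have mean0 : \sum_k pp s0 k * ((lab s0 k == c)%:R * (h s0 k - b)) = 0.
  under eq_bigr do rewrite mulrA mulrBr.
  by rewrite sumrB -mulr_suml -/al /b mulrC mulfVK ?subrr // gt_eqF.
have [k3 [pk3 lk3 hk3]] : exists k, [/\ 0 < pp s0 k, lab s0 k = c & h s0 k != b].
  have [e|ne] := eqVneq (h s0 k1) b; last by exists k1.
  by exists k2; split => //; rewrite -e eq_sym.
have [[kp [pkp lkp hkp]] [km [pkm lkm hkm]]] :=
  split_class UU C sgl labl hM hh mi_s0 mean0 pk3 lk3 hk3.
have C' := refine_config UU ooU C mi_i mi_good sgl labl hM hh b.
set pp' := shift_lim U mi pp in C' pkp pkm *.
set h' := shift_lim U mi h in C' hkp hkm *.
set lab2 := (fun s k => _) in C'.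
have sub : (classes pp lab \subset fst @: classes pp' lab2)%SET.
  apply/fintype.subsetP => d /(fintype.subsetP (classes_lim UU C sgl labl)).
  move=> /imsetP[k pk ->]; apply/imsetP.
  by exists (lab2 0%N k) => //; apply/imsetP; exists k.
exists #|classes pp' lab2|; split; last by exists _, pp', sg', lab2.
(* Forgetting the side of [b] maps the new labels onto a set containing the old ones, but identifies
   those of [kp] and [km]. *)
rewrite (leq_ltn_trans (subset_leq_card sub)) // ltn_neqAle leq_imset_card andbT.
apply/negP => /imset_injP inj.
have : lab2 0%N kp = lab2 0%N km.
  apply: inj; last by rewrite /lab2 /= lkp lkm.
  - by apply/imsetP; exists kp.
  - by apply/imsetP; exists km.
by rewrite /lab2 => -[_]; rewrite hkp ltNge (ltW hkm).
Qed.

(** Ranks are at most [#|K|], so one is maximal; a harmonic function separating two states of equal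
    label would raise it. *)
Lemma max_rank_config v p1 n : config_rank v p1 n ->
  exists (L : finType) pp sg (lab : nat -> K -> L), config v p1 pp sg lab /\
    forall h (M : R), (forall s k, `|h s k| <= M) -> supp_harmonic pp sg h ->
    forall s k k', 0 < pp s k -> 0 < pp s k' -> lab s k = lab s k' ->
    h s k = h s k'.
Proof.
move=> hn.
have ex : exists n, `[< config_rank v p1 n >] by exists n; apply/asboolP.
have ub m : `[< config_rank v p1 m >] -> (m <= #|K|)%N.
  by move=> /asboolP[L [pp [sg [lab [_ <-]]]]]; exact: classes_card.
case: (ex_maxnP ex ub) => m /asboolP[L [pp [sg [lab [C cm]]]]] mx.
exists L, pp, sg, lab; split => // h M hM hh s k k' pk pk' lk.
apply/eqP; apply: contraT => hk.
have [j [+ /asboolP/mx jm]] := rank_increase C hM hh pk pk' lk hk.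
by rewrite cm ltnNge jm.
Qed.

(** * Repeatable blocks of actions *)

Fixpoint back (sg : nat -> A) (m n : nat) (f : K -> R) : K -> R :=
  if n is n'.+1 then pull (sg m) (back sg m.+1 n' f) else f.

(** Given the state at stage [m], [back] is the expectation of [f] at stage [m + n], and [rsum] that
    of the total reward of stages [m] to [m + n - 1]. *)
Fixpoint rsum (sg : nat -> A) (m n : nat) : K -> R :=
  if n is n'.+1 then fun k => g k (sg m) + pull (sg m) (rsum sg m.+1 n') k
  else fun=> 0.

Lemma back_pair pp sg m n f : trajectory pp sg ->
  \sum_k pp m k * back sg m n f k = \sum_k pp (m + n)%N k * f k.
Proof.
move=> T; elim: n m => [|n IH] m /=; first by rewrite addn0.
by rewrite -(traj_pair T) IH addSnnS.
Qed.

Lemma rsum_pair pp sg m n : trajectory pp sg ->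
  \sum_k pp m k * rsum sg m n k = \sum_(s < n) reward pp sg (m + s)%N.
Proof.
move=> T; elim: n m => [|n IH] m /=.
  by rewrite big_ord0 big1 // => k _; rewrite mulr0.
under eq_bigr do rewrite mulrDr.
rewrite big_split /= -(traj_pair T) IH big_ord_recl /= addn0; congr (_ + _).
by apply: eq_bigr => i _; rewrite addSnnS.
Qed.

Lemma rsum_ge0 sg m n k : 0 <= rsum sg m n k.
Proof.
elim: n m k => [//|n IH] m k /=; rewrite addr_ge0 //.
  by have /andP[] := g01 k (sg m).
by apply: sumr_ge0 => k' _; rewrite mulr_ge0.
Qed.

Lemma rsum_le sg m n k : rsum sg m n k <= n%:R.
Proof.
elim: n m k => [//|n IH] m k /=; rewrite -natr1 addrC lerD //.
  by rewrite -[leRHS](pull_cst (sg m) n%:R k); apply: le_pull => k' _.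
by have /andP[] := g01 k (sg m).
Qed.

Lemma back_delta sg m n f k :
  back sg m n f k = \sum_y back sg m n (fun z => (z == y)%:R) k * f y.
Proof.
elim: n m k => [|n IH] m k /=.
  rewrite (bigD1 k) //= eqxx mul1r big1 ?addr0 // => y /negbTE.
  by rewrite eq_sym => ->; rewrite mul0r.
rewrite /pull; under [LHS]eq_bigr do rewrite IH mulr_sumr.
rewrite exchange_big /=; apply: eq_bigr => y _; rewrite mulr_suml.
by apply: eq_bigr => k' _; rewrite mulrA.
Qed.

Lemma back_ge0 sg m n f k : (forall k, 0 <= f k) -> 0 <= back sg m n f k.
Proof.
move=> f0; elim: n m k => [//|n IH] m k /=.
by apply: sumr_ge0 => k' _; rewrite mulr_ge0.
Qed.

Lemma back_le sg m n f k b : (forall k, f k <= b) -> back sg m n f k <= b.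
Proof.
move=> f0; elim: n m k => [//|n IH] m k /=.
by rewrite -[leRHS](pull_cst (sg m) b k); apply: le_pull => k' _.
Qed.

Section Block.
Variables (U : set_system nat) (UU : UltraFilter U) (ooU : \oo `<=` U).

(** Limit of the probability of being in [y] at time [j], from [k] at time [m]. Truncation in
    [j - m] is harmless, since [U] contains the set of all [j >= m]. *)
Definition limit_law (sg : nat -> A) (y : K) (m : nat) (k : K) : R :=
  ulim U (fun j => back sg m (j - m)%N (fun z => (z == y)%:R) k).

Lemma back_delta_norm sg m n (y k : K) :
  `|back sg m n (fun z => (z == y)%:R) k| <= 1.
Proof.
rewrite ger0_norm; last by apply: back_ge0 => k'.
by apply: back_le => k'; case: (_ == _).
Qed.

Lemma limit_lawP sg y m k :
  (fun j => back sg m (j - m)%N (fun z => (z == y)%:R) k) @ U --> limit_law sg y m k.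
Proof. by apply: (@ulimP _ _ _ _ 1) => i; exact: back_delta_norm. Qed.

Lemma limit_law_norm sg y m k : `|limit_law sg y m k| <= 1.
Proof.
have h1 : (fun _ : nat => 1 : R) @ U --> (1 : R) by exact: cvg_cst.
apply: (cvgr_le _ (cvg_norm (@limit_lawP sg y m k)) h1).
by apply: filterE => i /=; exact: back_delta_norm.
Qed.

Lemma limit_law_harmonic sg y m k :
  limit_law sg y m k = pull (sg m) (limit_law sg y m.+1) k.
Proof.
have h : (fun j => \sum_k' tr k (sg m) k' *
    back sg m.+1 (j - m.+1)%N (fun z => (z == y)%:R) k') @ U -->
    pull (sg m) (limit_law sg y m.+1) k.
  by apply: cvgr_sum => k'; apply: cvgM; [exact: cvg_cst | exact: limit_lawP].
apply: (cvgr_eq _ (@limit_lawP sg y m k) h).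
apply: filterS (ultra_ge ooU m.+1) => j /= mj.
by rewrite -(subnSK mj).
Qed.

Lemma traj_limit_law pp sg y : trajectory pp sg ->
  pp^~ y @ U --> \sum_k pp 0%N k * limit_law sg y 0%N k.
Proof.
move=> T.
have h : (fun j => \sum_k pp 0%N k * back sg 0 (j - 0)%N (fun z => (z == y)%:R) k)
    @ U --> \sum_k pp 0%N k * limit_law sg y 0%N k.
  by apply: cvgr_sum => k; apply: cvgM; [exact: cvg_cst | exact: limit_lawP].
apply: cvg_trans h; apply: near_eq_cvg; apply: filterE => j.
rewrite (back_pair _ _ _ T) subn0 add0n (bigD1 y) //= eqxx mulr1 big1 ?addr0 //.
by move=> k /negbTE ->; rewrite mulr0.
Qed.

End Block.

(* For maximal rank the limit laws of the chain depend on the label only, so a long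
   block between two times with the same support and labels almost resets the law
   inside each class, without any leak between classes. *)
Lemma good_block v p1 (L : finType) pp sg (lab : nat -> K -> L) (e : R) :
  config v p1 pp sg lab -> 0 < e ->
  (forall h (M : R), (forall s k, `|h s k| <= M) -> supp_harmonic pp sg h ->
    forall s k k', 0 < pp s k -> 0 < pp s k' -> lab s k = lab s k' ->
    h s k = h s k') ->
  exists i t (rho : K -> R), [/\ (0 < t)%N,
    forall k, (0 < pp (i + t)%N k) = (0 < pp i k) /\ lab (i + t)%N k = lab i k,
    forall k k', 0 < pp i k -> 0 < pp i k' -> lab i k = lab i k' -> rho k = rho k',
    forall k, t%:R * rho k <= back sg i t (rsum sg i t) k &
    v - e <= \sum_k pp i k * rho k /\ exists B, 0 < B /\ forall k, `|rho k| <= B].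
Proof.
move=> C e0 mx; have T := cf_traj C.
have [U [UU ooU]] := free_ultrafilter.
pose N y m k := limit_law U sg y m k.
pose n : R := #|K|%:R.
have n0 : 0 <= n by rewrite /n.
(* Error budget: [n * d] is deducted in [rho], [n * d] comes from replacing [pp i] by its limit, and
   [2 * d] from the average reward of the block. *)
pose d := e / (2 * n + 2).
have d0 : 0 < d by rewrite divr_gt0 //; lra.
have dE : d * (2 * n + 2) = e by rewrite /d mulfVK // gt_eqF //; lra.
(* Supports and labels take finitely many values, so one pair [c0] occurs at [U]-almost all times;
   [i] and [j] are both taken among these. *)
have [c0 Gc0] := ultra_fin (U := U) (fun i =>
  ([ffun k => 0 < pp i k], [ffun k => lab i k])).
have near1 : U [set i | forall y, `|\sum_k pp 0%N k * N y 0%N k - pp i y| <= d].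
  apply: filter_forall => y.
  exact: cvgr_dist_le _ _ (@traj_limit_law U UU pp sg y T) _ d0.
have [i /= [i1 ic]] := filter_ex (filterI near1 Gc0).
have near2 : U [set j | forall k y,
    `|N y i k - back sg i (j - i)%N (fun z => (z == y)%:R) k| <= d].
  apply: filter_forall => k; apply: filter_forall => y.
  exact: cvgr_dist_le _ _ (@limit_lawP U UU sg y i k) _ d0.
have [n1 rew] := cf_rew C d0.
(* A block of length at least [B] makes the first [i] stages cost at most [d] per stage of the
   block. *)
pose B := (Num.truncn (i%:R * (1 + `|v| + d) / d)).+1.
have [j /= [[j2 jc] [jn1 jB]]] := filter_ex (filterI (filterI near2 Gc0)
  (filterI (ultra_ge ooU n1) (ultra_ge ooU (i + B)%N))).
have ij : (i <= j)%N by rewrite (leq_trans _ jB) ?leq_addr.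
move: jB; rewrite -(subnKC ij) leq_add2l => tB; set t := (j - i)%N in tB j2.
have t0 : (0 < t)%N by rewrite (leq_trans _ tB).
have t0R : 0 < t%:R :> R by rewrite ltr0n.
have jE : j = (i + t)%N by rewrite subnKC.
pose r := rsum sg i t.
(* Average reward of the block when its initial state follows the limit law from [k]; deducting
   [n * d] covers the distance to the law after [t] stages. *)
pose rho k := (\sum_y N y i k * r y) / t%:R - n * d.
exists i, t, rho; split => //.
- move=> k; move: jc; rewrite -ic jE => -[/ffunP/(_ k) + /ffunP/(_ k)].
  by rewrite !ffunE.
- move=> k k' pk pk' lk; rewrite /rho; congr (_ / _ - _); apply: eq_bigr => y _.
  congr (_ * _).
  (* Maximality enters here: the limit laws are bounded and harmonic, so on the support they depend
     on the label only. *)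
  apply: (mx (N y) 1 _ _ i k k') => //; first by move=> s k0; exact: limit_law_norm.
  by move=> s k0 _; exact: limit_law_harmonic.
- move=> k; rewrite /rho mulrBr mulrC mulfVK ?gt_eqF // lerBlDr.
  rewrite back_delta -/r.
  have -> : t%:R * (n * d) = \sum_(y : K) d * t%:R.
    by rewrite sumr_const -mulr_natr -/n; ring.
  rewrite -big_split /=; apply: ler_sum => y _.
  rewrite -lerBlDl -mulrBl; apply: le_trans (ler_norm _) _.
  rewrite normrM ler_pM // ger0_norm ?rsum_ge0 // rsum_le //.
split.
- rewrite /rho; under eq_bigr do rewrite mulrBr mulrA.
  rewrite sumrB -!mulr_suml (traj_sum T) mul1r.
  have hr : v - 2 * d <= (\sum_y pp i y * r y) / t%:R.
    rewrite ler_pdivlMr // /r (rsum_pair _ _ T).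
    have := rew _ jn1; rewrite jE big_split_ord /= => h1.
    have h2 : \sum_(m < i) reward pp sg m <= i%:R.
      apply: le_trans (_ : \sum_(m < i) 1 <= _).
        by apply: ler_sum => m _; exact: reward_le1 T.
      by rewrite sumr_const card_ord.
    have h3 : i%:R * (1 + `|v| + d) < t%:R * d.
      rewrite -ltr_pdivrMr //; apply: lt_le_trans (truncnS_gt _) _.
      by rewrite ler_nat.
    have : i%:R * - v <= i%:R * `|v| by rewrite ler_wpM2l // -normrN ler_norm.
    move: h1 h2 h3; rewrite natrD.
    set S1 := \sum_(m < i) _; set S2 := \sum_(m < t) _.
    rewrite !mulrDr !mulrN !mulrDl => h1 h2 h3 h4.
    by lra.
  (* The limit laws have constant mean along the trajectory, so time [i] is exchanged for time 0,
     where [i1] compares the mean with [pp i]. *)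
  have mean : \sum_k pp i k * (\sum_y N y i k * r y) =
      \sum_y (\sum_k pp 0%N k * N y 0%N k) * r y.
    under eq_bigr do rewrite mulr_sumr.
    rewrite exchange_big /=; apply: eq_bigr => y _.
    under eq_bigr do rewrite mulrA.
    rewrite -mulr_suml; congr (_ * _).
    by apply: (@supp_harmonic_mean pp sg T (N y)) => s k _; exact: limit_law_harmonic.
  have close : \sum_y pp i y * r y - t%:R * (n * d) <=
      \sum_k pp i k * (\sum_y N y i k * r y).
    rewrite mean lerBlDr.
    have -> : t%:R * (n * d) = \sum_(y : K) d * t%:R.
      by rewrite sumr_const -mulr_natr -/n; ring.
    rewrite -big_split /=; apply: ler_sum => y _.
    rewrite -lerBlDl -mulrBl; apply: le_trans (ler_norm _) _.
    by rewrite normrM distrC ler_pM // ger0_norm ?rsum_ge0 // rsum_le.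
  have : (\sum_y pp i y * r y - t%:R * (n * d)) / t%:R <=
      (\sum_k pp i k * (\sum_y N y i k * r y)) / t%:R.
    by rewrite ler_pM2r ?invr_gt0.
  rewrite mulrBl [t%:R * _]mulrC mulfK ?gt_eqF //.
  by move: dE hr; lra.
- exists (n + n * d + 1); split; first by rewrite ltr_wpDl // addr_ge0 // mulr_ge0 // ltW.
  move=> k; apply: le_trans (ler_normB _ _) _.
  rewrite (ger0_norm (mulr_ge0 n0 (ltW d0))) -addrA lerD ?lerDl //.
  rewrite normrM normfV (ger0_norm (ltW t0R)) ler_pdivrMr //.
  apply: le_trans (ler_norm_sum _ _ _) _.
  have -> : n * t%:R = \sum_(y : K) t%:R by rewrite sumr_const -[RHS]mulr_natl.
  apply: ler_sum => y _.
  rewrite normrM -[leRHS]mul1r ler_pM ?limit_law_norm //.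
  by rewrite ger0_norm ?rsum_ge0 // rsum_le.
Qed.

(** * Drift certificates for periodic sequences of actions *)

Lemma pullD a f f' k : pull a (fun z => f z + f' z) k = pull a f k + pull a f' k.
Proof. by rewrite /pull -big_split; apply: eq_bigr => z _; rewrite mulrDr. Qed.

(* It makes (reward collected since stage m) + h n (state at stage m + n) - n x a
   submartingale with bounded increments for every play in state k0 at stage m. *)
Definition drift_certificate (tau : nat -> A) (m : nat) (k0 : K) (x : R) : Prop :=
  exists (D : nat -> pred K) (h : nat -> K -> R) (H : R),
  [/\ D 0%N k0,
      forall n k k', D n k -> 0 < tr k (tau (m + n)%N) k' -> D n.+1 k',
      forall n k, `|h n k| <= H &
      forall n k, D n k ->
        h n k + x <= g k (tau (m + n)%N) + pull (tau (m + n)%N) (h n.+1) k].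

Lemma modnS_cases n t : (0 < t)%N ->
  (n.+1 %% t = (n %% t).+1 /\ (n %% t).+1 < t)%N \/
  (n.+1 %% t = 0 /\ (n %% t).+1 = t)%N.
Proof.
move=> t0; have := ltn_pmod n t0; rewrite leq_eqVlt => /orP[/eqP e|l].
  by right; rewrite -addn1 -modnDml addn1 e modnn.
by left; rewrite -addn1 -modnDml addn1 modn_small.
Qed.

(* The potential is the expected reward, in excess of x per stage, until the end of
   the current block, plus the expected reward of the next block. *)
Lemma block_certificate (L : finType) v p1 pp sg (lab : nat -> K -> L) tau m i t
    (rho : K -> R) k0 :
  config v p1 pp sg lab -> (0 < t)%N ->
  (forall k, (0 < pp (i + t)%N k) = (0 < pp i k) /\ lab (i + t)%N k = lab i k) ->
  (forall k k', 0 < pp i k -> 0 < pp i k' -> lab i k = lab i k' -> rho k = rho k') ->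
  (forall k, t%:R * rho k <= back sg i t (rsum sg i t) k) ->
  (forall n, tau (m + n)%N = sg (i + n %% t)%N) ->
  0 < pp i k0 -> drift_certificate tau m k0 (rho k0).
Proof.
move=> C t0 per rhoc rhoQ tauE pk0; have T := cf_traj C.
pose x := rho k0; pose r := rsum sg i t.
pose D n := [pred k | (0 < pp (i + n %% t)%N k) &&
  (lab (i + n %% t)%N k == lab i k0)].
pose f l k := back sg (i + l) (t - l) r k + rsum sg (i + l) (t - l) k
  - (t - l)%:R * x.
have fS l k : (l < t)%N ->
    f l k + x = g k (sg (i + l)%N) + pull (sg (i + l)%N) (f l.+1) k.
  move=> lt; rewrite /f (_ : t - l = (t - l.+1).+1)%N; last by rewrite subnSK.
  rewrite /= !pullD pull_cst addnS -natr1; ring.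
have Dstep n k k' : D n k -> 0 < tr k (tau (m + n)%N) k' -> D n.+1 k'.
  rewrite tauE /D /= => /andP[pk /eqP lk] tk.
  have := traj_succ T pk tk; have := cf_lab C pk tk; rewrite lk -addnS.
  have [[-> _]|[-> ->]] := modnS_cases n t0; first by move=> -> ->; rewrite eqxx.
  by have [-> ->] := per k'; rewrite addn0 => -> ->; rewrite eqxx.
exists D, (fun n => f (n %% t)%N), (t%:R + t%:R + t%:R * `|x|); split => //.
- by rewrite /D /= mod0n addn0 pk0 eqxx.
- move=> n k; rewrite /f; set l := (n %% t)%N.
  have tl : (t - l)%:R <= t%:R :> R by rewrite ler_nat leq_subr.
  apply: le_trans (ler_normB _ _) _; rewrite lerD //; last first.
    by rewrite normrM ger0_norm // ler_wpM2r.
  rewrite ger0_norm; last first.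
    by rewrite addr_ge0 ?rsum_ge0 // back_ge0 // => k'; exact: rsum_ge0.
  rewrite lerD //; first by apply: back_le => k'; exact: rsum_le.
  exact: le_trans (rsum_le _ _ _ _) tl.
- move=> n k Dk; rewrite tauE fS ?ltn_pmod // lerD2l; apply: le_pull => k'.
  rewrite -tauE => tk; have := Dstep _ _ _ Dk tk; rewrite /D /=.
  have [[-> _] //|[-> ->]] := modnS_cases n t0.
  (* At the end of a block [f t k'] is [r k'], and restarting at phase 0 adds
     [back sg i t r k' - t * x], which is nonnegative by [rhoQ] because [rho k' = x] on the
     class. *)
  rewrite addn0 => /andP[pk' /eqP lk'].
  rewrite /f subnn subn0 /= mul0r subr0 !addr0 addn0 -/r addrAC lerDr subr_ge0.
  by rewrite /x (rhoc k0 k') // rhoQ.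
Qed.

(** With a single label the given beliefs form a configuration, so one of maximal rank exists. Its
    good block is repeated after a prefix that nearly reaches the belief where the block starts; [S]
    is the support of that belief. *)
Lemma periodic_certificate (v : R) (p1 : K -> R) (sg : nat -> A) (e : R) :
  (forall k, 0 <= p1 k) -> \sum_k p1 k = 1 ->
  (forall d, 0 < d -> exists n0, forall n, (n0 <= n)%N ->
     n%:R * (v - d) <= \sum_(m < n) reward (belief p1 sg) sg m) ->
  0 < e ->
  exists (tau : nat -> A) (m t : nat) (rho : K -> R) (S : pred K),
  [/\ (0 < t)%N, forall n, (m <= n)%N -> tau (n + t)%N = tau n,
      v - e <= \sum_(k | S k) belief p1 tau m k * rho k &
      forall k, S k -> drift_certificate tau m k (rho k)].
Proof.
move=> p10 p11 rew e0.
have T0 := belief_trajectory sg p10 p11.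
have C0 : config v p1 (belief p1 sg) sg (fun _ _ => tt).
  split => // m d d0; exists sg, m; rewrite big1 ?ltW // => k _.
  by rewrite subrr normr0.
have r0 : config_rank v p1 #|classes (belief p1 sg) (fun _ _ => tt)|.
  by exists unit, (belief p1 sg), sg, (fun _ _ => tt).
have [L [pp [sg' [lab [C mx]]]]] := max_rank_config r0.
have e20 : 0 < e / 2 by lra.
have [i [t [rho [t0 per rhoc rhoQ [rhov [B [B0 rhoB]]]]]]] := good_block C e20 mx.
have T := cf_traj C.
(* Since [rho] is bounded by [B], this l1 error in the belief costs at most [e / 2]; the block costs
   the other half. *)
have dB : 0 < e / 2 / B by rewrite divr_gt0.
have [tau0 [m hm]] := cf_appr C i dB.
pose tau n := if (n < m)%N then tau0 n else sg' (i + (n - m) %% t)%N.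
have tauE n : tau (m + n)%N = sg' (i + n %% t)%N.
  by rewrite /tau ltnNge leq_addr /= addKn.
exists tau, m, t, rho, [pred k | 0 < pp i k]; split => //.
- by move=> n mn; rewrite -(subnKC mn) -addnA !tauE modnDr.
- have -> : belief p1 tau m = belief p1 tau0 m.
    by apply: eq_belief => j jm; rewrite /tau jm.
  have -> : v - e = v - e / 2 - e / 2 by lra.
  rewrite lerBlDr; apply: le_trans rhov _.
  rewrite (bigID [pred k | 0 < pp i k]) /= [X in _ + X <= _]big1 ?addr0; last first.
    move=> k; rewrite -leNgt => pk.
    have -> : pp i k = 0 by apply/eqP; rewrite eq_le pk (traj_ge0 T).
    by rewrite mul0r.
  rewrite -lerBlDl -sumrB.
  apply: le_trans (_ : \sum_(k | 0 < pp i k) `|belief p1 tau0 m k - pp i k| * B <= _).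
    apply: ler_sum => k _; rewrite -mulrBl; apply: le_trans (ler_norm _) _.
    by rewrite normrM distrC ler_wpM2l.
  rewrite -mulr_suml -ler_pdivlMr //; apply: le_trans hm.
  by rewrite [leRHS](bigID [pred k | 0 < pp i k]) /= lerDl sumr_ge0.
- by move=> k pk; exact: block_certificate C t0 per rhoc rhoQ tauE pk.
Qed.
End Trajectories.

(** * Exponential moments along finite histories *)

Lemma expR_le_quadratic (R : realType) (x : R) :
  x <= 2^-1 -> expR x <= 1 + x + 2 * x ^+ 2.
Proof.
move=> xle.
have h : 1 - x <= expR (- x) by exact: expR_ge1Dx.
have x1 : 0 < 1 - x by lra.
have q0 : 0 <= 1 + x + 2 * x ^+ 2 by have := sqr_ge0 (x + 4^-1); lra.
rewrite -[leLHS]mulr1 -ler_pdivlMl ?expR_gt0 // -expRN.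
(* As [1 - x <= expR (- x)], it remains to see that this product is at least 1, which holds for
   [x <= 1 / 2]. *)
apply: le_trans (_ : (1 - x) * (1 + x + 2 * x ^+ 2) <= _); last by rewrite ler_wpM2r.
have : 0 <= x ^+ 2 * (1 - 2 * x) by rewrite mulr_ge0 ?sqr_ge0 //; lra.
have -> : (1 - x) * (1 + x + 2 * x ^+ 2) = 1 + x ^+ 2 * (1 - 2 * x) by ring.
lra.
Qed.

Section PathLaw.
Variables (R : realType) (K A : finType).
Variables (tr : K -> A -> K -> R) (g : K -> A -> R).
Hypothesis tr0 : forall k a k', 0 <= tr k a k'.
Hypothesis tr1 : forall k a, \sum_k' tr k a k' = 1.
Hypothesis g01 : forall k a, 0 <= g k a <= 1.
Variables (p1 : K -> R) (tau : nat -> A) (kd : K).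
Hypothesis p10 : forall k, 0 <= p1 k.
Hypothesis p11 : \sum_k p1 k = 1.

(* Finite histories are listed with the most recent state first. *)
Fixpoint paths (n : nat) : seq (seq K) :=
  if n is n'.+1 then [seq x :: t | t <- paths n', x <- index_enum K]
  else [seq [:: x] | x <- index_enum K].

(** Probability of a history under [p1] and [tau]. A list of [n.+1] states ends at stage [n], hence
    the predecessor of the size in the action. *)
Fixpoint weight (t : seq K) : R :=
  if t is x :: t' then
    if t' is y :: _ then weight t' * tr y (tau (size t').-1) x else p1 x
  else 0.

Lemma paths_size n t : t \in paths n -> size t = n.+1.
Proof.
elim: n t => [|n IH] t /=; first by move=> /mapP[x _ ->].
by move=> /allpairsP[[t' x] /= [/IH <- _ ->]].
Qed.

Lemma big_paths n (F : seq K -> R) :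
  \sum_(t <- paths n.+1) F t = \sum_(t <- paths n) \sum_x F (x :: t).
Proof. by rewrite /= big_allpairs_dep. Qed.

Lemma weight_ge0 t : 0 <= weight t.
Proof.
by elim: t => [//|x [|y t'] IH] /=; [exact: p10 | rewrite mulr_ge0].
Qed.

Lemma weight_cons n x t : t \in paths n ->
  weight (x :: t) = weight t * tr (head kd t) (tau n) x.
Proof. by case: t => [|y t'] /paths_size //= [->]. Qed.

Lemma sum_weight_head n f :
  \sum_(t <- paths n) weight t * f (head kd t) = \sum_k belief tr p1 tau n k * f k.
Proof.
elim: n f => [|n IH] f; first by rewrite big_map.
rewrite big_paths [in RHS]/= push_pull -IH big_seq [RHS]big_seq; apply: eq_bigr => t tn.
rewrite /pull mulr_sumr; apply: eq_bigr => x _.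
by rewrite (weight_cons _ tn) mulrA.
Qed.

Section Certificate.
Variables (m : nat) (k0 : K) (x e : R) (D : nat -> pred K) (h : nat -> K -> R) (H : R).
Hypothesis e0 : 0 < e.
Hypothesis D0 : D 0%N k0.
Hypothesis DS : forall n k k', D n k -> 0 < tr k (tau (m + n)%N) k' -> D n.+1 k'.
Hypothesis hH : forall n k, `|h n k| <= H.
Hypothesis drift : forall n k, D n k ->
  h n k + x <= g k (tau (m + n)%N) + pull tr (tau (m + n)%N) (h n.+1) k.

(** Step of the submartingale of the certificate with [x - e] in place of [x]; on [D] its
    conditional mean is at least [e]. *)
Definition increment n (y z : K) : R :=
  g y (tau (m + n)%N) - (x - e) + h n.+1 z - h n y.

Let B := 1 + `|x - e| + (H + H) + e.

(** Minimiser in [r] of [1 - r * e + 2 * (r * B) ^+ 2], the bound on the exponential moment of an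
    increment; [decay] is the minimum. *)
Definition rate : R := e / (4 * B ^+ 2).

Definition decay : R := 1 - e ^+ 2 / (8 * B ^+ 2).

Let H0 : 0 <= H. Proof. exact: le_trans (normr_ge0 _) (hH 0%N kd). Qed.

Let B1 : 1 <= B.
Proof. by rewrite /B; have := H0; have := normr_ge0 (x - e); have := ltW e0; lra. Qed.

Let eB : e <= B.
Proof. by rewrite /B; have := H0; have := normr_ge0 (x - e); lra. Qed.

Lemma increment_norm n y z : `|increment n y z| <= B.
Proof.
rewrite /increment.
have /andP[g0 g1] := g01 y (tau (m + n)%N).
have := hH n.+1 z; have := hH n y; have := ler_norm (x - e).
have : - `|x - e| <= x - e by rewrite lerNl -normrN ler_norm.
by rewrite !ler_norml /B; have := ltW e0; lra.
Qed.

Lemma rate_gt0 : 0 < rate.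
Proof. by rewrite divr_gt0 // mulr_gt0 // exprn_gt0 //; have := B1; lra. Qed.

Lemma decay_itv : 0 <= decay < 1.
Proof.
have B20 : 0 < 8 * B ^+ 2 by rewrite mulr_gt0 // exprn_gt0 //; have := B1; lra.
apply/andP; split; last by rewrite gtrDl oppr_lt0 divr_gt0 // exprn_gt0.
rewrite subr_ge0 ler_pdivrMr // mul1r.
have : e ^+ 2 <= B ^+ 2 by rewrite lerXn2r // nnegrE ?(ltW e0) //; have := B1; lra.
by have := sqr_ge0 B; lra.
Qed.

Lemma exp_increment n y : D n y ->
  pull tr (tau (m + n)%N) (fun z => expR (- (rate * increment n y z))) y <= decay.
Proof.
move=> Dy; set a := tau _.
have B0 : 0 < B by have := B1; lra.
have rB : rate * B = e / (4 * B) by rewrite /rate; field; rewrite gt_eqF.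
have rB2 : rate * B <= 2^-1.
  by rewrite rB ler_pdivrMr ?mulr_gt0 //; have := eB; lra.
have r0 := rate_gt0.
apply: le_trans (_ : pull tr a (fun z => (1 + 2 * (rate * B) ^+ 2 ) +
    (- rate) * increment n y z) y <= _).
  apply: le_pull => // z _; set u := increment n y z.
  have uB : `|rate * u| <= rate * B.
    by rewrite normrM gtr0_norm // ler_pM2l // increment_norm.
  apply: le_trans (expR_le_quadratic _) _.
    by apply: le_trans (ler_norm _) _; rewrite normrN (le_trans uB).
  have : (rate * u) ^+ 2 <= (rate * B) ^+ 2.
    by rewrite -(real_normK (num_real (rate * u))) lerXn2r // nnegrE mulr_ge0 // ltW.
  by rewrite sqrrN mulNr; lra.
rewrite pullD pull_cst //.
have -> : pull tr a (fun z => - rate * increment n y z) y =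
    - rate * (g y a - (x - e) - h n y + pull tr a (h n.+1) y).
  rewrite -[X in X + pull _ _ _ _](@pull_cst _ _ _ tr tr1 a _ y) -pullD.
  rewrite /pull mulr_sumr; apply: eq_bigr => z _.
  by rewrite /increment -/a mulrCA; congr (_ * (_ * _)); ring.
have dr := drift Dy; rewrite -/a in dr.
have {}dr : e <= g y a - (x - e) - h n y + pull tr a (h n.+1) y by lra.
have : rate * e <= rate * (g y a - (x - e) - h n y + pull tr a (h n.+1) y).
  by rewrite ler_pM2l.
have -> : decay = 1 + 2 * (rate * B) ^+ 2 - rate * e.
  by rewrite rB /decay /rate; field; rewrite gt_eqF.
by rewrite mulNr; lra.
Qed.

(** Exponential of minus [rate] times the increments since stage [m], on histories in state [k0] at
    that stage. Increment [n] follows a history of [m + n + 1] states, hence the shift by [m.+1]. *)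
Fixpoint potential (t : seq K) : R :=
  if t is z :: t' then
    if (size t' < m)%N then 1
    else if size t' == m then (z == k0)%:R
    else potential t' *
      expR (- (rate * increment (size t' - m.+1)%N (head kd t') z))
  else 0.

Lemma potential_cons n z t : t \in paths (m + n)%N ->
  potential (z :: t) =
  potential t * expR (- (rate * increment n (head kd t) z)).
Proof.
move=> /paths_size st /=; rewrite st ltnNge ltnW ?ltnS ?leq_addr //=.
by rewrite gtn_eqF ?ltnS ?leq_addr // subSS addKn.
Qed.

Lemma potential_ge0 t : 0 <= potential t.
Proof.
elim: t => [//|z t IH] /=; case: ifP => // _; case: ifP => // _.
by rewrite mulr_ge0 // expR_ge0.
Qed.

Lemma potential_dom n t : t \in paths (m + n)%N ->
  weight t * potential t != 0 -> D n (head kd t).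
Proof.
elim: n t => [|n IH] t.
  rewrite addn0; case: t => [|z t] /paths_size //= [->].
  rewrite ltnn eqxx; case: (z =P k0) => [->//|_].
  by rewrite mulr0 eqxx.
rewrite addnS /= => /allpairsP[[t' z] /= [t'n _ ->]].
rewrite (potential_cons _ t'n) (weight_cons _ t'n) /= => nz.
have w0 : weight t' * potential t' != 0.
  by apply: contraNneq nz => E; rewrite mulrACA E mul0r.
apply: DS (IH _ t'n w0) _; rewrite lt_def tr0 andbT.
by apply: contraNneq nz => ->; rewrite mulr0 mul0r.
Qed.

(** Each stage multiplies the mean potential by at most [decay], since [potential_dom] places all
    contributing histories in [D]. *)
Lemma sum_potential n :
  \sum_(t <- paths (m + n)%N) weight t * potential t <= decay ^+ n.
Proof.
have /andP[c0 _] := decay_itv.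
elim: n => [|n IH].
  rewrite expr0 addn0.
  have -> : \sum_(t <- paths m) weight t * potential t =
      \sum_(t <- paths m) weight t * (head kd t == k0)%:R.
    rewrite big_seq [RHS]big_seq; apply: eq_bigr => t.
    case: t => [|z t] /paths_size //= [->].
    by rewrite ltnn eqxx.
  rewrite (sum_weight_head m (fun k => (k == k0)%:R)).
  rewrite -[leRHS]p11 -(belief_sum tr1 p1 tau m); apply: ler_sum => k _.
  rewrite ler_piMr ?belief_ge0 //.
  by case: (k == k0).
rewrite addnS big_paths exprS; apply: le_trans (ler_wpM2l c0 IH).
rewrite mulr_sumr big_seq [leRHS]big_seq; apply: ler_sum => t tn.
have -> : \sum_z weight (z :: t) * potential (z :: t) =
   weight t * potential t * pull tr (tau (m + n)%N)
      (fun z => expR (- (rate * increment n (head kd t) z))) (head kd t).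
  rewrite /pull mulr_sumr; apply: eq_bigr => z _.
  by rewrite (potential_cons _ tn) (weight_cons _ tn) mulrACA.
have [->|nz] := eqVneq (weight t * potential t) 0; first by rewrite mul0r mulr0.
rewrite mulrC ler_wpM2r ?mulr_ge0 ?weight_ge0 ?potential_ge0 //.
exact/exp_increment/potential_dom.
Qed.

End Certificate.
End PathLaw.

(** * Union bounds, lower limits and geometric series *)

Lemma measure_bigsetU_le d (T : measurableType d) (R : realType)
    (mu : {measure set T -> \bar R}) (I : Type) (r : seq I) (Q : pred I)
    (F : I -> set T) : (forall i, measurable (F i)) ->
  (mu (\big[setU/set0]_(i <- r | Q i) F i) <= \sum_(i <- r | Q i) mu (F i))%E.
Proof.
move=> mF; elim: r => [|i r IH]; first by rewrite !big_nil measure0.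
rewrite !big_cons; case: ifP => _ //.
apply: le_trans (measureU2 _ _ _) _ => //; first exact: bigsetU_measurable.
by rewrite leeD2l.
Qed.

Lemma limn_einf_ge (R : realType) (u : nat -> \bar R) (c : \bar R) :
  (exists N, forall n, (N <= n)%N -> (c <= u n)%E) -> (c <= limn_einf u)%E.
Proof.
move=> [N h]; rewrite limn_einf_lim; apply: lime_ge; first exact: is_cvg_einfs.
exists N => // n /= Nn; apply: le_ereal_inf_tmp => _ [j /= nj <-].
by apply: h; exact: leq_trans nj.
Qed.

Lemma limn_einf_gt (R : realType) (u : nat -> \bar R) (c : \bar R) :
  (c < limn_einf u)%E -> exists N, forall n, (N <= n)%N -> (c <= u n)%E.
Proof.
rewrite limn_einf_lim => cu; apply: contrapT => /forallNP no.
move: cu; apply/negP; rewrite -leNgt; apply: lime_le; first exact: is_cvg_einfs.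
apply: nearW => N; have /existsNP[n /not_implyP[Nn /negP]] := no N.
rewrite -ltNge => /ltW; apply: le_trans.
by apply: ereal_inf_lbound; exists n.
Qed.

Lemma geometric_series_finite (R : realType) (c th : R) (u : nat -> \bar R) :
  0 <= c -> 0 <= th < 1 -> (forall n, (0 <= u n)%E) ->
  (forall n, (u n <= (c * th ^+ n)%:E)%E) -> (\sum_(n <oo) u n < +oo)%E.
Proof.
move=> c0 /andP[th0 th1] u0 uth.
apply: (@le_lt_trans _ _ (c / (1 - th))%:E); last exact: ltry.
apply: lime_le; first exact: is_cvg_nneseries.
apply: nearW => n; apply: le_trans (_ : \sum_(0 <= i < n) (c * th ^+ i)%:E <= _)%E.
  exact: lee_sum.
have t0 : 0 < 1 - th by rewrite subr_gt0.
rewrite sumEFin lee_fin -mulr_sumr ler_pdivlMr // -mulrA ler_piMr //.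
have -> : (\sum_(0 <= i < n) th ^+ i) * (1 - th) = 1 - th ^+ n.
  by rewrite big_mkord -[RHS]opprB subrX1; ring.
by rewrite gerDl oppr_le0 exprn_ge0.
Qed.

(** * The state process and its average rewards *)

Section Process.
Variables (R : realType) (K A : finType).
Variables (tr : K -> A -> K -> R) (g : K -> A -> R).
Hypothesis tr0 : forall k a k', 0 <= tr k a k'.
Hypothesis tr1 : forall k a, \sum_k' tr k a k' = 1.
Hypothesis g01 : forall k a, 0 <= g k a <= 1.
Variables (p1 : K -> R) (tau : nat -> A) (kd : K).
Hypothesis p10 : forall k, 0 <= p1 k.
Hypothesis p11 : \sum_k p1 k = 1.
Variables (d : measure_display) (Omega : measurableType d) (P : probability Omega R).
Variable Y : nat -> Omega -> K.
Hypothesis mY : forall m k, measurable (Y m @^-1` [set k]).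
Hypothesis lawY : forall (n : nat) (x : nat -> K),
  P [set w | forall m, (m <= n)%N -> Y m w = x m] =
  (p1 (x 0%N) * \prod_(m < n) tr (x m) (tau m) (x m.+1))%:E.

Fixpoint history (n : nat) (w : Omega) : seq K :=
  if n is n'.+1 then Y n w :: history n' w else [:: Y 0%N w].

Lemma history_paths n w : history n w \in paths K n.
Proof.
elim: n => [|n IH] /=; first by apply/mapP; exists (Y 0%N w); rewrite ?mem_index_enum.
by apply/allpairsP; exists (history n w, Y n.+1 w); split; rewrite //= mem_index_enum.
Qed.

Lemma measurable_history n t : measurable [set w | history n w = t].
Proof.
elim: n t => [|n IH] [|z t] /=.
- by rewrite (_ : [set _ | _] = set0) // -subset0 => w.
- case: t => [|z' t].
    rewrite (_ : [set _ | _] = Y 0%N @^-1` [set z]) //.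
    by apply/seteqP; split => w /= => [[]//|->].
  by rewrite (_ : [set _ | _] = set0) // -subset0 => w.
- by rewrite (_ : [set _ | _] = set0) // -subset0 => w.
- rewrite (_ : [set _ | _] = Y n.+1 @^-1` [set z] `&` [set w | history n w = t]).
    exact: measurableI.
  by apply/seteqP; split => w /= => [[]//|[-> ->]].
Qed.

Lemma prob_history n t : t \in paths K n ->
  P [set w | history n w = t] = (weight tr p1 tau t)%:E.
Proof.
(* [lawY] speaks of functions of time while histories list the latest state first, so stage [m] is
   read from the end. *)
move=> tn; pose x (t : seq K) m := nth kd t ((size t).-1 - m)%N.
have hx w j t' : t' \in paths K j ->
    history j w = t' <-> forall m, (m <= j)%N -> Y m w = x t' m.
  elim: j t' => [|j IH] t' /=.
    move=> /mapP[z _ ->]; split=> [[<-] m|/(_ 0%N isT) ->//].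
    by rewrite leqn0 => /eqP ->.
  move=> /allpairsP[[t2 z] /= [t2j _ ->]].
  have sz := paths_size t2j.
  have xE m : (m <= j)%N -> x (z :: t2) m = x t2 m.
    by move=> mj; rewrite /x /= sz subSn.
  have xl : x (z :: t2) j.+1 = z by rewrite /x /= sz subnn.
  split.
    move=> [e /(IH _ t2j) h] m; rewrite leq_eqVlt => /predU1P[->|mj].
      by rewrite xl.
    by rewrite xE // h.
  move=> h; rewrite -[in RHS]xl -(h j.+1 (leqnn _)); congr (_ :: _).
  by apply/(IH _ t2j) => m mj; rewrite h ?xE // leqW.
have -> : [set w | history n w = t] = [set w | forall m, (m <= n)%N -> Y m w = x t m].
  by apply/seteqP; split => w /=; apply (hx w n t tn).
rewrite lawY; congr (_%:E).
elim: n t tn => [|n IH] t /=.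
  by move=> /mapP[z _ ->]; rewrite big_ord0 mulr1.
move=> /allpairsP[[t2 z] /= [t2n _ ->]].
have sz := paths_size t2n.
rewrite big_ord_recr /= mulrA.
have -> : p1 (x (z :: t2) 0%N) * \prod_(i < n) tr (x (z :: t2) i) (tau i)
    (x (z :: t2) i.+1) = weight tr p1 tau t2.
  rewrite -IH // /x /= sz /= !subn0 /=; congr (_ * _).
  by apply: eq_bigr => i _; rewrite !subSn // ltnW.
have := @weight_cons _ _ _ tr p1 tau kd n z t2 t2n => /= ->.
by rewrite /x /= sz subnn subSnn /= nth0.
Qed.

Lemma event_bigsetU n (f : pred (seq K)) : [set w | f (history n w)] =
  \big[setU/set0]_(t <- paths K n | f t) [set w | history n w = t].
Proof.
rewrite -bigcup_seq_cond; apply/seteqP; split => w /= => [fw|[t /= /andP[_ ft] ->]//].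
by exists (history n w) => //=; rewrite history_paths fw.
Qed.

Lemma measurable_event n (f : pred (seq K)) : measurable [set w | f (history n w)].
Proof.
rewrite event_bigsetU.
by apply: bigsetU_measurable => t _; exact: measurable_history.
Qed.

Lemma prob_event_le n (f : pred (seq K)) :
  (P [set w | f (history n w)] <= (\sum_(t <- paths K n | f t) weight tr p1 tau t)%:E)%E.
Proof.
rewrite event_bigsetU.
apply: le_trans (measure_bigsetU_le _ _ _ _) _; first exact: measurable_history.
rewrite -sumEFin big_seq_cond [leRHS]big_seq_cond le_eqVlt; apply/orP; left.
by apply/eqP; apply: eq_bigr => t /andP[tn _]; exact: prob_history.
Qed.

Lemma head_history n w : head kd (history n w) = Y n w.
Proof. by case: n. Qed.

Lemma prob_state_le n k : (P (Y n @^-1` [set k]) <= (belief tr p1 tau n k)%:E)%E.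
Proof.
have := prob_event_le n (fun t => head kd t == k).
rewrite (_ : [set _ | _] = Y n @^-1` [set k]); last first.
  by apply/seteqP; split => w /=; rewrite head_history => /eqP.
move=> /le_trans; apply; rewrite lee_fin big_mkcond /=.
have -> : belief tr p1 tau n k = \sum_k' belief tr p1 tau n k' * (k' == k)%:R.
  by rewrite (bigD1 k) //= eqxx mulr1 big1 ?addr0 // => i /negbTE ->; rewrite mulr0.
rewrite -(sum_weight_head tr p1 tau kd); apply: ler_sum => t _.
by case: (_ == k); rewrite ?mulr1 ?mulr0.
Qed.

(** Upper bounds that sum to 1 are attained, because the states exhaust [Omega] and so their
    probabilities sum to at least 1. *)
Lemma prob_state n k : P (Y n @^-1` [set k]) = (belief tr p1 tau n k)%:E.
Proof.
have f j : P (Y n @^-1` [set j]) = (fine (P (Y n @^-1` [set j])))%:E.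
  by rewrite fineK // fin_num_measure.
have tot : 1 <= \sum_j fine (P (Y n @^-1` [set j])).
  rewrite -lee_fin -sumEFin; under eq_bigr do rewrite -f.
  rewrite -(@probability_setT _ _ _ P); apply: le_trans (measure_bigsetU_le _ _ _ _).
    rewrite le_eqVlt; apply/orP; left; apply/eqP; congr (P _); apply/seteqP.
    by split => // w _; rewrite -bigcup_seq /=; exists (Y n w) => //=;
      rewrite mem_index_enum.
  by move=> j; exact: mY.
have le j : fine (P (Y n @^-1` [set j])) <= belief tr p1 tau n j.
  by rewrite -lee_fin -f prob_state_le.
rewrite f; congr (_%:E).
have z : \sum_j (belief tr p1 tau n j - fine (P (Y n @^-1` [set j]))) = 0.
  apply/eqP; rewrite eq_le sumrB belief_sum // p11 subr_le0 tot /=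
    -p11 -(belief_sum tr1 p1 tau n) subr_ge0.
  by apply: ler_sum.
have /eqP : belief tr p1 tau n k - fine (P (Y n @^-1` [set k])) = 0.
  by apply: (sumr_eq0_pos _ z) => j; rewrite subr_ge0.
by rewrite subr_eq0 => /eqP ->.
Qed.

Lemma measurable_state (f : K -> R) n :
  measurable_fun setT (fun w => f (Y n w)).
Proof.
move=> _ V mV; rewrite setTI.
rewrite (_ : _ @^-1` V =
  \big[setU/set0]_(k <- index_enum K | f k \in V) (Y n @^-1` [set k])).
  by apply: bigsetU_measurable.
rewrite -bigcup_seq_cond; apply/seteqP; split => w /=.
  by move=> Vw; exists (Y n w) => //=; rewrite mem_index_enum /= inE.
by move=> [k /= /andP[_]]; rewrite inE => Vk ->.
Qed.

Lemma integral_state (f : K -> R) n : (forall k, 0 <= f k) ->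
  (\int[P]_w (f (Y n w))%:E = (\sum_k belief tr p1 tau n k * f k)%:E)%E.
Proof.
move=> f0.
have E w : (f (Y n w))%:E =
    (\sum_(k <- index_enum K) (f k)%:E * (\1_(Y n @^-1` [set k]) w)%:E)%E.
  rewrite (bigD1 (Y n w)) //= indicE mem_set //= mule1 big1 ?adde0 // => k kw.
  rewrite indicE memNset ?mule0 //= => e; move: kw; by rewrite e eqxx.
under eq_integral do rewrite E.
rewrite ge0_integral_sum //; last first.
- by move=> k w _; rewrite mule_ge0 ?lee_fin.
- move=> k; apply: measurable_funeM.
  by apply/measurable_EFinP; exact: measurable_indic.
rewrite -sumEFin; apply: eq_bigr => k _.
rewrite ge0_integralZl //; last first.
- by rewrite lee_fin.
- by apply/measurable_EFinP; exact: measurable_indic.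
rewrite integral_indic // setIT EFinM muleC; congr (_ * _)%E; exact: prob_state.
Qed.


Lemma potential_history m n k0 x e h H w : Y m w = k0 ->
  potential g tau kd m k0 x e h H (history (m + n)%N w) =
  expR (- (rate x e H * (\sum_(l < n) g (Y (m + l)%N w) (tau (m + l)%N)
     - n%:R * (x - e) + h n (Y (m + n)%N w) - h 0%N k0))).
Proof.
move=> Ym; elim: n => [|n IH].
  rewrite addn0 big_ord0 mul0r subr0 add0r Ym subrr mulr0 oppr0 expR0.
  have := history_paths m w; have := head_history m w; rewrite Ym.
  case: (history m w) => [|z t] /= zk /paths_size //= [->].
  by rewrite ltnn eqxx zk eqxx.
rewrite addnS -[history _.+1 w]/(Y (m + n).+1 w :: history (m + n) w).
rewrite (potential_cons _ _ _ _ _ _ _ _ _ (history_paths _ _)).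
rewrite IH head_history -expRD; congr expR.
by rewrite /increment big_ord_recr /= -natr1; ring.
Qed.

(** A reward sum below [n * (x - e)] keeps the potential above a constant, an event of geometrically
    small probability by Markov's inequality; Borel-Cantelli leaves finitely many such [n]. *)
Lemma certificate_ae m k0 (x e : R) : 0 < e -> drift_certificate tr g tau m k0 x ->
  {ae P, forall w, Y m w = k0 -> exists N, forall n, (N <= n)%N ->
    n%:R * (x - e) <= \sum_(l < n) g (Y (m + l)%N w) (tau (m + l)%N)}.
Proof.
move=> e0 [D [h [H [D0 DS hH drift]]]].
pose pot := potential g tau kd m k0 x e h H.
(* [H + H] bounds the difference of the two boundary values of [h] in the exponent. *)
pose c0 := expR (- (rate x e H * (H + H))).
have c00 : 0 < c0 by exact: expR_gt0.
pose B n := [set w | c0 <= pot (history (m + n)%N w)].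
have mB n : measurable (B n).
  exact: (measurable_event (m + n) (fun t => c0 <= pot t)).
have c1 := decay_itv kd x e0 hH.
have PB n : (P (B n) <= (c0^-1 * decay x e H ^+ n)%:E)%E.
  apply: le_trans (prob_event_le (m + n) (fun t => c0 <= pot t)) _.
  rewrite lee_fin ler_pdivlMl //.
  apply: le_trans (sum_potential tr0 tr1 g01 kd p10 p11 e0 D0 DS hH drift n).
  rewrite mulr_sumr big_mkcond; apply: ler_sum => t _.
  have w0 : 0 <= weight tr p1 tau t by exact: weight_ge0.
  case: ifP => ct; first by rewrite mulrC ler_wpM2l.
  by rewrite mulr_ge0 // potential_ge0.
have lim0 : P (lim_sup_set B) = 0.
  apply: lim_sup_set_cvg0 => //; apply: geometric_series_finite c1 _ PB => //.
  by rewrite invr_ge0 ltW.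
exists (lim_sup_set B); split => //.
  by apply: bigcap_measurable => // n _; exact: bigcup_measurable.
move=> w /= nw; apply: contrapT => nB; apply: nw => Ym.
have [N hN] : exists N, forall n, (N <= n)%N -> ~ B n w.
  apply: contrapT => /forallNP noN; apply: nB => N _.
  apply: contrapT => h1; apply: (noN N) => n Nn Bn; apply: h1.
  by exists n.
exists N => n /hN Bn; rewrite leNgt; apply/negP => low; apply: Bn.
rewrite /B /= /pot potential_history // /c0 ler_expR lerN2.
rewrite ler_pM2l ?(rate_gt0 kd x e0 hH) //.
have := ler_norm (h n (Y (m + n)%N w)); have := hH n (Y (m + n)%N w).
have := ler_norm (- h 0%N k0); rewrite normrN; have := hH 0%N k0.
by lra.
Qed.

Definition average (w : Omega) (n : nat) : R :=
  n.+1%:R^-1 * \sum_(m < n.+1) g (Y m w) (tau m).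

Lemma average_ge0 w n : 0 <= average w n.
Proof.
rewrite mulr_ge0 ?invr_ge0 // sumr_ge0 // => m _.
by have /andP[] := g01 (Y m w) (tau m).
Qed.

Lemma measurable_average n : measurable_fun setT (fun w => (average w n)%:E).
Proof.
apply/measurable_EFinP; apply: measurable_funM; first exact: measurable_cst.
apply: measurable_sum => m; exact: (measurable_state (fun k => g k (tau m))).
Qed.

Lemma measurable_liminf_average :
  measurable_fun setT (fun w => limn_einf (fun n => (average w n)%:E)).
Proof.
apply: (measurableT_comp (f := -%E)); first exact: oppe_measurable.
apply: measurable_fun_limn_esup => n.
apply: (measurableT_comp (f := -%E)); first exact: oppe_measurable.
exact: measurable_average.
Qed.

Lemma integral_average n :
  (\int[P]_w (average w n)%:E =
  (n.+1%:R^-1 * \sum_(m < n.+1) reward g (belief tr p1 tau) tau m)%:E)%E.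
Proof.
have E w : ((average w n)%:E = n.+1%:R^-1%:E *
    \sum_(m <- index_enum 'I_n.+1) (g (Y m w) (tau m))%:E)%E.
  by rewrite sumEFin -EFinM.
have ms (m : 'I_n.+1) : measurable_fun setT (fun w => (g (Y m w) (tau m))%:E).
  by apply/measurable_EFinP; exact: (measurable_state (fun k => g k (tau m))).
have s0 (m : 'I_n.+1) w : (0 <= (g (Y m w) (tau m))%:E)%E.
  by rewrite lee_fin; have /andP[] := g01 (Y m w) (tau m).
under eq_integral do rewrite E.
rewrite ge0_integralZl //; last 2 first.
- exact: emeasurable_sum.
- by move=> w _; exact: sume_ge0.
rewrite ge0_integral_sum // EFinM -sumEFin; congr (_ * _)%E; apply: eq_bigr => m _.
rewrite (@integral_state (fun k => g k (tau m)) m) // => k.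
by have /andP[] := g01 k (tau m).
Qed.

Lemma integral_liminf_average_le :
  (\int[P]_w limn_einf (fun n => (average w n)%:E) <=
   limn_einf (fun n => (n.+1%:R^-1 *
     \sum_(m < n.+1) reward g (belief tr p1 tau) tau m)%:E))%E.
Proof.
under [X in (_ <= limn_einf X)%E]funext do rewrite -integral_average.
apply: (@fatou _ _ _ P setT measurableT (fun n w => (average w n)%:E)).
- by move=> n; exact: measurable_average.
- by move=> n w _; rewrite lee_fin average_ge0.
Qed.

Lemma liminf_average_ge w m (x e : R) N : 0 < e ->
  (forall n, (N <= n)%N ->
    n%:R * (x - e) <= \sum_(l < n) g (Y (m + l)%N w) (tau (m + l)%N)) ->
  ((x - 2 * e)%:E <= limn_einf (fun n => (average w n)%:E))%E.
Proof.
move=> e0 h; apply: limn_einf_ge.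
(* The first [m] stages cost at most [m * |x - e|], hence at most [e] per stage once [b] stages
   follow. *)
pose b := (Num.truncn (m%:R * `|x - e| / e)).+1.
exists (m + N + b)%N => n hn.
rewrite lee_fin /average ler_pdivlMl ?ltr0n //.
have mn : (m <= n.+1)%N by lia.
rewrite -(subnKC mn); set j := (n.+1 - m)%N.
have Nj : (N <= j)%N by rewrite /j; lia.
rewrite big_split_ord /=; apply: le_trans (_ : j%:R * (x - e) <= _); last first.
  apply: le_trans (h _ Nj) _; rewrite lerDr sumr_ge0 // => i _.
  by have /andP[] := g01 (Y i w) (tau i).
have hj : m%:R * `|x - e| <= j%:R * e.
  rewrite -ler_pdivrMr //; apply: le_trans (ltW (truncnS_gt _)) _.
  by rewrite -/b ler_nat /j; lia.
have := ler_norm (x - e) => /(ler_wpM2l (ler0n R m)) hx.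
rewrite natrD mulrDl.
have -> : x - 2 * e = (x - e) - e by ring.
rewrite !mulrBr in hx hj *.
have : 0 <= m%:R * e by rewrite mulr_ge0 // ltW.
by lra.
Qed.

(** From state [k] at stage [m], the lower limit is almost surely at least [rho k - 2 * e]: one [e]
    is lost in the certificate, another on the first [m] stages. *)
Lemma integral_liminf_average_ge m (S : pred K) (rho : K -> R) e : 0 < e ->
  (forall k, S k -> drift_certificate tr g tau m k (rho k)) ->
  ((\sum_(k | S k) belief tr p1 tau m k * rho k - 2 * e)%:E <=
   \int[P]_w limn_einf (fun n => (average w n)%:E))%E.
Proof.
move=> e0 cert.
(* Truncation at 0 makes [f] nonnegative for integration; the comparison survives because averages
   are nonnegative. *)
pose f k := Num.max 0 (if S k then rho k - 2 * e else 0).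
have f0 k : 0 <= f k by rewrite le_max lexx.
apply: le_trans (_ : (\int[P]_w (f (Y m w))%:E <= _)%E).
  rewrite integral_state // lee_fin.
  apply: le_trans (_ : \sum_(k | S k) belief tr p1 tau m k * (rho k - 2 * e) <= _).
    under [leRHS]eq_bigr do rewrite mulrBr.
    rewrite sumrB lerD2l lerN2 -mulr_suml ler_piMl //; first by rewrite mulr_ge0 // ltW.
    rewrite -p11 -(belief_sum tr1 p1 tau m) [leRHS](bigID S) /= lerDl.
    rewrite sumr_ge0 // => k _.
    exact: belief_ge0.
  rewrite big_mkcond; apply: ler_sum => k _; case: ifP => Sk.
    by rewrite ler_wpM2l ?belief_ge0 // /f Sk le_max lexx orbT.
  by rewrite mulr_ge0 // belief_ge0.
have L0 w : (0 <= limn_einf (fun n => (average w n)%:E))%E.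
  by apply: limn_einf_ge; exists 0%N => n _; rewrite lee_fin average_ge0.
apply: ae_ge0_le_integral => //.
- by move=> w _; rewrite lee_fin.
- by apply/measurable_EFinP; exact: measurable_state.
- exact: measurable_liminf_average.
(* There are finitely many states, so the exceptional null sets can be united. *)
have : \forall w \ae P, forall k : K, S k -> Y m w = k -> exists N, forall n,
    (N <= n)%N ->
    n%:R * (rho k - e) <= \sum_(l < n) g (Y (m + l)%N w) (tau (m + l)%N).
  apply: filter_forall => k.
  have [Sk|nSk] := boolP (S k); last by apply: nearW => w.
  have := certificate_ae e0 (cert k Sk).
  by apply: filterS => w hw _; exact: hw.
apply: filterS => w hw _; rewrite /f.
case: ifP => Sk; last by rewrite maxxx.
have [N hN] := hw _ Sk erefl.
by rewrite EFin_max ge_max L0 /= (liminf_average_ge e0 hN).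
Qed.

End Process.

(** * Transition probabilities and conclusion for the blind MDP *)

Lemma trans_ge0 (R : realType) (K A S : finType) (q : K -> A -> {ffun (K * S) -> R})
    (g : K -> A -> R) : is_POMDP q g -> forall k a k', 0 <= trans q k a k'.
Proof. by move=> [hq _] k a k'; apply: sumr_ge0 => s _; have [q0 _] := hq k a. Qed.

Lemma trans_sum (R : realType) (K A S : finType) (q : K -> A -> {ffun (K * S) -> R})
    (g : K -> A -> R) : is_POMDP q g -> forall k a, \sum_k' trans q k a k' = 1.
Proof.
move=> [hq _] k a; have [_ <-] := hq k a.
by rewrite /trans pair_big /=; apply: eq_bigr => -[].
Qed.

Theorem theorem2 (R : realType) (K A S : finType)
  (q : K -> A -> {ffun (K * S) -> R}) (g : K -> A -> R)
  (hA : (0 < #|A|)%N) (hG : is_blind_MDP q g)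
  (p1 : {ffun K -> R}) (hp1 : is_distr p1)
  (d : measure_display) (Omega : measurableType d) (P : probability Omega R)
  (X : strategy A -> nat -> Omega -> K) (hX : realizes P p1 q X)
  (eps : R) (heps : 0 < eps) :
  exists sigma : strategy A,
    eps_optimal P g X eps sigma /\ eventually_periodic sigma.
Proof.
have [hP _] := hG; have g01 := hP.2.
have tr0 := trans_ge0 hP; have tr1 := trans_sum hP.
have [p10 p11] := hp1; have [mX lawX] := hX.
have [kd _] : exists k : K, True.
  apply: contrapT => /forallNP noK; have /eqP := oner_eq0 R.
  by rewrite -p11 big1 ?eqxx // => k; case: (noK k).
have [a0 _] := card_gt0P hA.
have upper sg : (gamma_inf P g X sg <= limn_einf (fun n => (n.+1%:R^-1 *
    \sum_(m < n.+1) reward g (belief (trans q) p1 sg) sg m)%:E))%E.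
  exact (integral_liminf_average_le tr1 g01 kd p11 (mX sg) (lawX sg)).
have lower sg : (0 <= gamma_inf P g X sg)%E.
  apply: integral_ge0 => w _; apply: limn_einf_ge; exists 0%N => n _.
  by rewrite lee_fin; exact: (average_ge0 g01 sg (X sg) w n).
have T sg := belief_trajectory tr0 tr1 sg p10 p11.
(* A crude bound that makes the value finite. As [limn_einf_gt] returns a weak inequality, 2 rather
   than 1 contradicts averages at most 1. *)
have le2 sg : (gamma_inf P g X sg <= 2%:E)%E.
  apply: le_trans (upper sg) _; rewrite leNgt; apply/negP => /limn_einf_gt[N].
  move=> /(_ _ (leqnn N)); rewrite lee_fin ler_pdivlMl ?ltr0n //.
  apply/negP; rewrite -ltNge; apply: le_lt_trans (_ : N.+1%:R * 1 < _).
    rewrite mulr1; apply: le_trans (_ : \sum_(m < N.+1) 1 <= _).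
      by apply: ler_sum => m _; exact: (reward_le1 g01 m (T sg)).
    by rewrite sumr_const card_ord.
  by rewrite ltr_pM2l ?ltr0n // ltr1n.
have v_ge0 : (0 <= v_inf P g X)%E.
  by apply: le_trans (lower (fun=> a0)) _; apply: ereal_sup_ubound; exists (fun=> a0).
have v_le2 : (v_inf P g X <= 2%:E)%E.
  by apply: ge_ereal_sup => _ [sg _ <-].
have vE : v_inf P g X = (fine (v_inf P g X))%:E.
  by rewrite fineK // ge0_fin_numE // (le_lt_trans v_le2) ?ltry.
set v := fine (v_inf P g X) in vE.
have [_ [sg _ <-] hsg] : exists2 y, [set gamma_inf P g X sigma | sigma in setT]%classic y &
    ((v - eps / 4)%:E < y)%E.
  by apply: ereal_sup_gt; rewrite -/(v_inf P g X) vE lte_fin gtrBl divr_gt0.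
have [N hN] := limn_einf_gt (lt_le_trans hsg (upper sg)).
have rew e : 0 < e -> exists n0, forall n, (n0 <= n)%N ->
    n%:R * (v - eps / 4 - e) <= \sum_(m < n) reward g (belief (trans q) p1 sg) sg m.
  move=> e0; exists N.+1 => -[//|n]; rewrite ltnS => /hN.
  rewrite lee_fin ler_pdivlMl ?ltr0n //; apply: le_trans.
  by rewrite ler_wpM2l // gerBl ltW.
(* Losses: [eps / 4] for the choice of [sg], [eps / 4] for periodicity and twice [eps / 8] for the
   almost sure bound, less than [eps] in total. *)
have e4 : 0 < eps / 4 by rewrite divr_gt0.
have e8 : 0 < eps / 8 by rewrite divr_gt0.
have [tau [m [t [rho [Sk [t0 per val cert]]]]]] :=
  periodic_certificate tr0 tr1 g01 p10 p11 rew e4.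
exists tau; split; last by exists t, m.
rewrite /eps_optimal vE -EFinB.
have := integral_liminf_average_ge tr0 tr1 g01 kd p10 p11 (mX tau) (lawX tau) e8 cert.
apply: le_trans; rewrite lee_fin.
by move: val; lra.
Qed.
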